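(* Let $m\ge1$ and let $\phi\colon\mathbb{S}^m(\tfrac12)\to\mathbb{S}^{m+1}$ be the small hypersphere considered as a critical point of $\hat E_4$. Then the quadratic form describing its normal index is given by $$\hat Q_4^{ES}(f\nu,f\nu)=3(m-1)(m-2)^2\int_{\mathbb{S}^m(\frac12)}|\nabla f|^2\,dv_g$$ for $f\in C^\infty(\mathbb{S}^m(\tfrac12))$, where $\nu$ is the unit normal. In particular, the small hypersphere is a weakly stable critical point of $\hat E_4$ with respect to normal variations, i.e. $\hat Q_4^{ES}(f\nu,f\nu)\ge0$ for all $f\in C^\infty(\mathbb{S}^m(\tfrac12))$.
   Context: $\mathbb{S}^m(\tfrac12)$ is the round sphere of radius $\tfrac12$ with its metric $g$, $\mathbb{S}^{m+1}$ is the unit round sphere, and the small hypersphere is the standard inclusion of $\mathbb{S}^m(\tfrac12)$ as a totally umbilic hypersurface, an isometric immersion. For a smooth map $\phi\colon(M,g)\to(N,h)$, $\tau(\phi)=\operatorname{Tr}_g\bar\nabla d\phi$ is the tension field ($\bar\nabla$ the connection on $\phi^\ast TN$), $R^N(X,Y)Z=\nabla_X\nabla_YZ-\nabla_Y\nabla_XZ-\nabla_{[X,Y]}Z$, and $$\hat E_4(\phi)=\frac14\int_M\sum_{i,j}|R^N(d\phi(e_i),d\phi(e_j))\tau(\phi)|^2\,dv_g$$ with $\{e_i\}$ a local orthonormal frame of $TM$. For a critical point $\phi$ of $\hat E_4$, $\hat Q_4^{ES}(V,V)=\frac{d^2}{dt^2}\big|_{t=0}\hat E_4(\phi_t)$ for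 a smooth variation $\phi_t$ of $\phi=\phi_0$ (domain metric fixed) with $\partial_t\phi_t|_{t=0}=V$. *)

(* Defs.v *)
From HB Require Import structures.
From mathcomp Require Import all_boot all_order all_algebra.
From mathcomp Require Import all_classical all_reals all_analysis.

Set Implicit Arguments.
Unset Strict Implicit.
Unset Printing Implicit Defensive.

Import Order.TTheory GRing.Theory Num.Theory.
Import numFieldNormedType.Exports.
Local Open Scope classical_set_scope.
Local Open Scope ring_scope.

(* For U open in a finite-dimensional space this is the usual class C^k(U):
   a function is C^(k+1) iff it is differentiable and all its directional
   derivatives are C^k. *)
Fixpoint Ck_on (R : realType) (V W : normedModType R) (k : nat) (U : set V)
    (F : V -> W) : Prop :=
  match k with
  | 0 => forall x, U x -> {for x, continuous F}
  | k'.+1 => (forall x, U x -> differentiable F x) /\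
             (forall v : V, Ck_on k' U (fun x => 'D_v F x))
  end.

Definition smooth_on (R : realType) (V W : normedModType R) (U : set V)
    (F : V -> W) : Prop := forall k, Ck_on k U F.

(* The norm of the library on matrices is the sup norm, so the Euclidean
   structure of R^n is introduced here (the topology is the same). *)
Definition dot (R : realType) (n : nat) (u v : 'rV[R]_n) : R :=
  (u *m v^T) 0 0.

Definition enorm (R : realType) (n : nat) (u : 'rV[R]_n) : R :=
  Num.sqrt (dot u u).

(* The round sphere S^n(r), embedded in R^(n+1) with the induced metric. Its
   tangent space at x is the orthogonal complement of x. Maps and vector fields
   on S^n(r) are functions on the ambient space of which only the values on
   S^n(r) matter. *)
Definition rsphere (R : realType) (n : nat) (r : R) : set 'rV[R]_(n + 1) :=
  [set x | enorm x = r].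

Definition rtangent (R : realType) (n : nat) (x : 'rV[R]_(n + 1)) :
    set 'rV[R]_(n + 1) := [set v | dot v x = 0].

(* Orthogonal projection of R^(n+1) onto the tangent space at x. *)
Definition tproj (R : realType) (n : nat) (x v : 'rV[R]_(n + 1)) :
    'rV[R]_(n + 1) := v - (dot v x / dot x x) *: x.

(* The smooth retraction of R^(n+1) minus the origin onto S^n(r). Precomposing
   with it extends a function F on S^n(r) to an open set, constantly along
   rays; F is smooth on S^n(r) iff this extension is smooth, and for v tangent
   at x the derivative of the extension along v is the differential dF_x(v). *)
Definition retr (R : realType) (n : nat) (r : R) (y : 'rV[R]_(n + 1)) :
    'rV[R]_(n + 1) := (r / enorm y) *: y.

Definition smooth_sphere (R : realType) (n : nat) (W : normedModType R)
    (r : R) (F : 'rV[R]_(n + 1) -> W) : Prop :=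
  smooth_on [set y : 'rV[R]_(n + 1) | y != 0] (fun y => F (retr r y)).

Definition sdiff (R : realType) (n : nat) (W : normedModType R) (r : R)
    (F : 'rV[R]_(n + 1) -> W) (x v : 'rV[R]_(n + 1)) : W :=
  'D_v (fun y => F (retr r y)) x.

(* An orthonormal basis of the tangent space at x (the rows of e). *)
Definition orthonormal_frame (R : realType) (n : nat) (x : 'rV[R]_(n + 1)) :
    set 'M[R]_(n, n + 1) :=
  [set e | e *m e^T = 1%:M /\ forall i, rtangent x (row i e)].

(* A choice of such a basis; the traces below do not depend on it. *)
Definition frame (R : realType) (n : nat) (x : 'rV[R]_(n + 1)) :
    'M[R]_(n, n + 1) := get (orthonormal_frame x).

Definition frame_vec (R : realType) (n : nat) (x : 'rV[R]_(n + 1)) (i : 'I_n) :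
    'rV[R]_(n + 1) := row i (frame x).

(* The connection induced on phi^* T S^n(s) by the Levi-Civita connection of
   S^n(s): derivative in the ambient space of a section W of the pull-back
   bundle along v, followed by the tangential projection. *)
Definition cov (R : realType) (m n : nat) (r : R)
    (phi W : 'rV[R]_(m + 1) -> 'rV[R]_(n + 1)) (x v : 'rV[R]_(m + 1)) :
    'rV[R]_(n + 1) := tproj (phi x) (sdiff r W x v).

(* The Levi-Civita connection of S^n(r) itself, on vector fields. *)
Definition nabla (R : realType) (n : nat) (r : R)
    (X Y : 'rV[R]_(n + 1) -> 'rV[R]_(n + 1)) (x : 'rV[R]_(n + 1)) :
    'rV[R]_(n + 1) := cov r id Y x (X x).

Definition lie_bracket (R : realType) (n : nat) (r : R)
    (X Y : 'rV[R]_(n + 1) -> 'rV[R]_(n + 1)) (x : 'rV[R]_(n + 1)) :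
    'rV[R]_(n + 1) := sdiff r Y x (X x) - sdiff r X x (Y x).

Definition curvature_field (R : realType) (n : nat) (r : R)
    (X Y Z : 'rV[R]_(n + 1) -> 'rV[R]_(n + 1)) (x : 'rV[R]_(n + 1)) :
    'rV[R]_(n + 1) :=
  nabla r X (nabla r Y Z) x - nabla r Y (nabla r X Z) x
  - nabla r (lie_bracket r X Y) Z x.

(* Extension of a vector u, tangent at some point, to a tangent vector field.
   It is used to evaluate tensors, which do not depend on the extension. *)
Definition tfield (R : realType) (n : nat) (u : 'rV[R]_(n + 1)) :
    'rV[R]_(n + 1) -> 'rV[R]_(n + 1) := fun y => tproj y u.

Definition curvature (R : realType) (n : nat) (r : R)
    (p u v w : 'rV[R]_(n + 1)) : 'rV[R]_(n + 1) :=
  curvature_field r (tfield u) (tfield v) (tfield w) p.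

(* (nabla d phi)(u, v) = nabla_u (d phi (Y)) - d phi (nabla_u Y) with Y(x) = v,
   for phi from S^m(r) to a sphere. *)
Definition second_fundamental_form (R : realType) (m n : nat) (r : R)
    (phi : 'rV[R]_(m + 1) -> 'rV[R]_(n + 1)) (x u v : 'rV[R]_(m + 1)) :
    'rV[R]_(n + 1) :=
  cov r phi (fun y => sdiff r phi y (tfield v y)) x u
  - sdiff r phi x (nabla r (tfield u) (tfield v) x).

Definition tension (R : realType) (m n : nat) (r : R)
    (phi : 'rV[R]_(m + 1) -> 'rV[R]_(n + 1)) (x : 'rV[R]_(m + 1)) :
    'rV[R]_(n + 1) :=
  \sum_(i < m) second_fundamental_form r phi x (frame_vec x i) (frame_vec x i).

Definition gradient (R : realType) (m : nat) (r : R)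
    (f : 'rV[R]_(m + 1) -> R) (x : 'rV[R]_(m + 1)) : 'rV[R]_(m + 1) :=
  \sum_(i < m) sdiff r f x (frame_vec x i) *: frame_vec x i.

(* The Lebesgue integral over R^n, as an iterated integral; it is only applied
   to continuous functions dominated by a product of integrable functions of
   one variable, for which Fubini's theorem holds. *)
Fixpoint Rn_integral (R : realType) (n : nat) : ('rV[R]_n -> R) -> R :=
  match n with
  | 0 => fun F => F 0
  | n'.+1 => fun F =>
      \int[lebesgue_measure]_x
        Rn_integral (fun v : 'rV[R]_n' => F (row_mx (x%:M : 'rV[R]_1) v))
  end.

(* Inverse of the stereographic projection, a parametrization of S^m(r) minus
   one point. *)
Definition stereo (R : realType) (m : nat) (r : R) (u : 'rV[R]_m) :
    'rV[R]_(m + 1) :=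
  (r / (1 + dot u u)) *: row_mx (2 *: u) ((dot u u - 1)%:M : 'rV[R]_1).

(* The integral over S^m(r) with respect to dv_g = sqrt(det g_ij) du, computed
   in the stereographic chart. *)
Definition sphere_integral (R : realType) (m : nat) (r : R)
    (F : 'rV[R]_(m + 1) -> R) : R :=
  Rn_integral (fun u : 'rV[R]_m =>
    F (stereo r u) *
    Num.sqrt (\det ('J (@stereo R m r) u *m ('J (@stereo R m r) u)^T))).

Definition E4_density (R : realType) (m n : nat) (r s : R)
    (phi : 'rV[R]_(m + 1) -> 'rV[R]_(n + 1)) (x : 'rV[R]_(m + 1)) : R :=
  \sum_(i < m) \sum_(j < m)
    enorm (curvature s (phi x) (sdiff r phi x (frame_vec x i))
             (sdiff r phi x (frame_vec x j)) (tension r phi x)) ^+ 2.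

Definition hatE4 (R : realType) (m n : nat) (r s : R)
    (phi : 'rV[R]_(m + 1) -> 'rV[R]_(n + 1)) : R :=
  4^-1 * sphere_integral r (E4_density r s phi).

Definition smooth_map (R : realType) (m n : nat) (r s : R)
    (phi : 'rV[R]_(m + 1) -> 'rV[R]_(n + 1)) : Prop :=
  smooth_sphere r phi /\
  forall x, rsphere r x -> rsphere s (phi x).

(* Smooth variations of phi through maps S^m(r) -> S^n(s), defined for
   |t| < eps with some eps > 0. *)
Definition smooth_variation (R : realType) (m n : nat) (r s : R)
    (phi : 'rV[R]_(m + 1) -> 'rV[R]_(n + 1))
    (Phi : R -> 'rV[R]_(m + 1) -> 'rV[R]_(n + 1)) : Prop :=
  exists2 eps : R, 0 < eps &
  [/\ smooth_on [set p : R * 'rV[R]_(m + 1) | `|p.1| < eps /\ p.2 != 0]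
        (fun p => Phi p.1 (retr r p.2)),
      forall t x, `|t| < eps -> rsphere r x -> rsphere s (Phi t x)
    & forall x, rsphere r x -> Phi 0 x = phi x].

Definition variation_field (R : realType) (m n : nat) (r : R)
    (Phi : R -> 'rV[R]_(m + 1) -> 'rV[R]_(n + 1))
    (V : 'rV[R]_(m + 1) -> 'rV[R]_(n + 1)) : Prop :=
  forall x, rsphere r x -> derive1 (fun t : R => Phi t x) 0 = V x.

Definition critical_hatE4 (R : realType) (m n : nat) (r s : R)
    (phi : 'rV[R]_(m + 1) -> 'rV[R]_(n + 1)) : Prop :=
  smooth_map r s phi /\
  forall Phi, smooth_variation r s phi Phi ->
    is_derive (0 : R) (1 : R) (fun t => hatE4 r s (Phi t)) 0.

(* The graph of the quadratic form \hat Q_4^{ES}: q is the second derivative at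
   t = 0 of \hat E_4 along every variation of phi with variation field V (and
   there is such a variation, so that q is determined by phi and V). *)
Definition hatQ4 (R : realType) (m n : nat) (r s : R)
    (phi V : 'rV[R]_(m + 1) -> 'rV[R]_(n + 1)) (q : R) : Prop :=
  (exists2 Phi, smooth_variation r s phi Phi & variation_field r Phi V) /\
  forall Phi, smooth_variation r s phi Phi -> variation_field r Phi V ->
    let E := fun t : R => hatE4 r s (Phi t) in
    (\forall t \near (0 : R), derivable E t 1) /\
    is_derive (0 : R) (1 : R) (derive1 E) q.

(* The totally umbilic inclusion of S^m(a) in S^(m+1), for 0 < a <= 1. *)
Definition hypersphere (R : realType) (m : nat) (a : R)
    (x : 'rV[R]_(m + 1)) : 'rV[R]_(m + 1 + 1) :=
  row_mx x ((Num.sqrt (1 - a ^+ 2))%:M : 'rV[R]_1).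

Definition unit_normal (R : realType) (m n : nat) (r : R)
    (phi nu : 'rV[R]_(m + 1) -> 'rV[R]_(n + 1)) : Prop :=
  smooth_sphere r nu /\
  forall x, rsphere r x ->
    [/\ rtangent (phi x) (nu x), enorm (nu x) = 1 &
        forall v, rtangent x v -> dot (nu x) (sdiff r phi x v) = 0].

(* Main.v *)
Require Import Defs.
From HB Require Import structures.
From mathcomp Require Import all_boot all_order all_algebra.
From mathcomp Require Import all_classical all_reals all_analysis.
From mathcomp Require Import measurable_realfun ring lra.

Set Implicit Arguments.
Unset Strict Implicit.
Unset Printing Implicit Defensive.

Import Order.TTheory GRing.Theory Num.Theory.
Import numFieldNormedType.Exports.
Local Open Scope classical_set_scope.
Local Open Scope ring_scope.

(** Write a_k = <D_k phi, tau(phi)> for the pairing of the differential of phi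
with its tension field. Since R(u,v)w = <v,w>u - <u,w>v on the unit sphere, the
integrand of the functional is the sum of |B_kl|^2 with
B_kl = a_l D_k phi - a_k D_l phi. For an isometric immersion the tension field is
normal, so a = 0 and the small hypersphere annihilates the nonnegative integrand.
It is therefore critical, and only the first variation B' = dB/dt enters the
second derivative of the integrand, which is twice the sum of |B'_kl|^2. As
a = 0, B'_kl = a'_l D_k phi - a'_k D_l phi, and phi being isometric this sum is
2 (m-1) |a'|^2 ([sum_wedge_sqr]). A direct computation for a normal variation
field gives a' = +-sqrt 3 (m-2) df ([stress_normal_variation]), whence the
constant 3 (m-1) (m-2)^2 after multiplication by the factor 1/4.

To make this a statement about functions of (t, y), maps on the sphere are
extended to the punctured space as functions W constant along rays. Then the
derivative along the radius vanishes, so traces over an orthonormal tangent frame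
become sums over the standard basis, and the tension field becomes the tangential
part of the flat Laplacian of W. This yields an expression of the integrand by
ordinary partial derivatives of the coordinates of W ([E4_densityE]), which is
smooth in (t, y) and in which time and space derivatives can be interchanged
([derive_comm]).

The integral over the sphere is an iterated integral in the stereographic chart.
On continuous functions bounded by a multiple of the product of the 1/(1+u_i^2)
it is linear and bounded, and this together with a Taylor estimate
uniform in u, which compactness of the sphere provides, is enough to
differentiate it in t ([is_derive_sphere_integral]). *)

(** * Smooth functions on open sets *)

Section calculus.
Context {R : realType} {V : normedModType R}.

Lemma differentiable_near_eq (W : normedModType R) (F G : V -> W) (x : V) :
  {near x, F =1 G} -> differentiable F x -> differentiable G x.
Proof.
move=> FG dF.
have -> : G = F + (G - F) by apply/funext => y /=; rewrite fctE /= addrC subrK.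
apply: differentiableD => //.
have GFx : (G - F) x = 0.
  by rewrite fctE /= [X in X - _](_ : _ = F x) ?subrr //; rewrite (nbhs_singleton FG).
have h0 : (G - F) \o shift x = cst ((G - F) x) + (0 : V -> W) +o_ 0 id.
  apply/eqaddoP => _/posnumP[e].
  rewrite near_simpl.
  have : \forall y \near (0 : V), F (y + x) = G (y + x).
    by move: FG; rewrite (near_shift 0 x) subr0.
  apply: filterS => y /= FGy.
  rewrite GFx /= !fctE /= FGy subrr /cst addr0 subr0 normr0 mulr_ge0 //.
have dh : 'd (G - F) x = 0 :> (V -> W).
  by apply/diff_unique => //; exact: cst_continuous.
by apply/diff_locallyP; rewrite dh; split => //; exact: cst_continuous.
Qed.

(** Derivatives at the points of U depend on the values near U; openness of U
is what makes the class C^k depend only on the restriction to U. *)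
Lemma Ck_on_ext (W : normedModType R) k (U : set V) (F G : V -> W) : open U ->
  (forall x, U x -> F x = G x) -> Ck_on k U F -> Ck_on k U G.
Proof.
move=> oU; elim: k F G => [|k IH] F G FG /=.
  move=> cF x Ux.
  have nFG : {near x, F =1 G} by apply: filterS (open_nbhs_nbhs (conj oU Ux)).
  rewrite /prop_for /continuous_at -(FG _ Ux).
  by apply: cvg_trans (cF x Ux); apply: near_eq_cvg; exact: nFG.
move=> [dF cF]; split=> [x Ux|v].
  apply: differentiable_near_eq (dF _ Ux).
  by apply: filterS (open_nbhs_nbhs (conj oU Ux)).
apply: IH (cF v) => x Ux.
apply: near_eq_derive.
by apply: filterS (open_nbhs_nbhs (conj oU Ux)).
Qed.

Lemma Ck_onS (W : normedModType R) k (U : set V) (F : V -> W) :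
  Ck_on k.+1 U F -> Ck_on k U F.
Proof.
elim: k F => [|k IH] F; first by move=> [dF _] x /dF /differentiable_continuous.
by move=> [dF cF]; split => // v; apply: IH; exact: cF.
Qed.

Lemma smooth_on_differentiable (W : normedModType R) (U : set V) (F : V -> W) x :
  smooth_on U F -> U x -> differentiable F x.
Proof. by move=> /(_ 1%N)[+ _] => /[apply]. Qed.

Lemma smooth_on_derivable (W : normedModType R) (U : set V) (F : V -> W) x v :
  smooth_on U F -> U x -> derivable F x v.
Proof. by move=> sF Ux; apply: diff_derivable; exact: smooth_on_differentiable Ux. Qed.

Lemma smooth_on_derive (W : normedModType R) (U : set V) (F : V -> W) v :
  smooth_on U F -> smooth_on U (fun x => 'D_v F x).
Proof. by move=> sF k; have [_] := sF k.+1; exact. Qed.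

Lemma smooth_on_cst (W : normedModType R) (U : set V) (a : W) :
  smooth_on U (fun _ => a).
Proof.
move=> k; elim: k a => [|k IH] a; first by move=> x _; exact: cst_continuous.
split=> [x _|v]; first exact: differentiable_cst.
rewrite (_ : (fun x => 'D_v _ x) = fun _ => 0); first exact: IH.
by apply/funext => x; rewrite derive_cst.
Qed.

Lemma smooth_on_linear (W : normedModType R) (U : set V) (F : {linear V -> W}) :
  continuous F -> smooth_on U F.
Proof.
move=> cF [|k]; first by move=> x _; exact: cF.
split=> [x _|v]; first exact: linear_differentiable.
rewrite (_ : (fun x => 'D_v _ x) = fun _ => F v); first exact: smooth_on_cst.
apply/funext => x; rewrite deriveE; last exact: linear_differentiable.
by rewrite diff_lin.
Qed.

Lemma smooth_on_id (U : set V) : smooth_on U (fun x : V => x).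
Proof. by apply: (@smooth_on_linear _ _ idfun) => x. Qed.

Lemma Ck_onD (W : normedModType R) k (U : set V) (F G : V -> W) : open U ->
  Ck_on k U F -> Ck_on k U G -> Ck_on k U (fun x => F x + G x).
Proof.
move=> oU; elim: k F G => [|k IH] F G.
  by move=> cF cG x Ux; apply: continuousD; [exact: cF|exact: cG].
move=> [dF cF] [dG cG]; split=> [x Ux|v].
  by apply: differentiableD; [exact: dF|exact: dG].
apply: Ck_on_ext (IH _ _ (cF v) (cG v)) => // x Ux.
by rewrite -deriveD //; apply: diff_derivable; [exact: dF|exact: dG].
Qed.

Lemma Ck_onM k (U : set V) (f g : V -> R) : open U ->
  Ck_on k U f -> Ck_on k U g -> Ck_on k U (fun x => f x * g x).
Proof.
move=> oU; elim: k f g => [|k IH] f g.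
  by move=> cF cG x Ux; apply: continuousM; [exact: cF|exact: cG].
move=> /[dup] /Ck_onS Cf [df cf] /[dup] /Ck_onS Cg [dg cg]; split=> [x Ux|v].
  by apply: differentiableM; [exact: df|exact: dg].
apply: Ck_on_ext (Ck_onD oU (IH _ _ Cf (cg v)) (IH _ _ Cg (cf v))) => // x Ux.
by rewrite -deriveM //; apply: diff_derivable; [exact: df|exact: dg].
Qed.

Lemma Ck_on_subset (W : normedModType R) k (U U' : set V) (F : V -> W) : U' `<=` U ->
  Ck_on k U F -> Ck_on k U' F.
Proof.
move=> UU; elim: k F => [|k IH] F; first by move=> cF x /UU /cF.
by move=> [dF cF]; split=> [x /UU /dF|v] //; apply: IH; exact: cF.
Qed.

Lemma smooth_onD (W : normedModType R) (U : set V) (F G : V -> W) : open U ->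
  smooth_on U F -> smooth_on U G -> smooth_on U (fun x => F x + G x).
Proof. by move=> oU sF sG k; exact: Ck_onD. Qed.

Lemma smooth_onM (U : set V) (f g : V -> R) : open U ->
  smooth_on U f -> smooth_on U g -> smooth_on U (fun x => f x * g x).
Proof. by move=> oU sF sG k; exact: Ck_onM. Qed.

Lemma smooth_onX (U : set V) (f : V -> R) k : open U ->
  smooth_on U f -> smooth_on U (fun x => f x ^+ k).
Proof.
move=> oU sf; elim: k => [|k IH]; first exact: smooth_on_cst.
by under eq_fun do rewrite exprS; exact: smooth_onM.
Qed.

Lemma smooth_onB (U : set V) (f g : V -> R) : open U ->
  smooth_on U f -> smooth_on U g -> smooth_on U (fun x => f x - g x).
Proof.
move=> oU sf sg; apply: smooth_onD => //.
rewrite (_ : (fun x => _) = fun x => -1 * g x); last by apply/funext => x; rewrite mulN1r.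
by apply: smooth_onM => //; exact: smooth_on_cst.
Qed.

Lemma smooth_on_sum (I : Type) (s : seq I) (U : set V) (f : I -> V -> R) : open U ->
  (forall i, smooth_on U (f i)) -> smooth_on U (fun x => \sum_(i <- s) f i x).
Proof.
move=> oU sf; elim: s => [|i s IH].
  rewrite (_ : (fun x => _) = fun x => 0); first exact: smooth_on_cst.
  by apply/funext => x; rewrite big_nil.
rewrite (_ : (fun x => _) = fun x => f i x + \sum_(j <- s) f j x).
  exact: smooth_onD.
by apply/funext => x; rewrite big_cons.
Qed.

(** The derivative of 1/f is a product of 1/f, 1/f and the derivative of f, so
the induction on k closes on products. *)
Lemma Ck_onV k (U : set V) (f : V -> R) : open U -> (forall x, U x -> f x != 0) ->
  Ck_on k U f -> Ck_on k U (fun x => (f x)^-1).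
Proof.
move=> oU f0; elim: k => [|k IH].
  by move=> cF x Ux; apply: continuousV; [exact: f0|exact: cF].
move=> /[dup] /Ck_onS Cf [df cf]; split=> [x Ux|v].
  by apply: differentiableV; [exact: df|exact: f0].
have /IH Cv := Cf.
have := Ck_onM oU (Ck_onM oU Cv Cv) (Ck_onM oU (@smooth_on_cst _ _ (-1 : R) k) (cf v)).
apply: Ck_on_ext => // x Ux.
rewrite deriveV ?f0 //; last by apply: diff_derivable; exact: df.
by rewrite mulrA mulrN1 -exprVn expr2.
Qed.

Lemma smooth_onV (U : set V) (f : V -> R) : open U -> (forall x, U x -> f x != 0) ->
  smooth_on U f -> smooth_on U (fun x => (f x)^-1).
Proof. by move=> oU f0 sf k; exact: Ck_onV. Qed.

Lemma is_derive_sqrt_comp (f : V -> R) x v : 0 < f x -> differentiable f x ->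
  differentiable (fun y => Num.sqrt (f y)) x /\
  'D_v (fun y => Num.sqrt (f y)) x = 2^-1 * (Num.sqrt (f x))^-1 * 'D_v f x.
Proof.
move=> fx0 df.
have ds := is_derive1_sqrt fx0.
have dsq : differentiable (@Num.sqrt R) (f x) by apply/derivable1_diffP; case: ds.
split; first exact: (differentiable_comp df dsq).
rewrite (@deriveE _ _ _ (Num.sqrt \o f)); last exact: (differentiable_comp df dsq).
rewrite diff_comp //= [in RHS]deriveE //.
rewrite -[in LHS](mulr1 ('d f x v)) -[_ * 1]/(_ *: _) linearZ /=.
have -> : 'd (@Num.sqrt R) (f x) 1 = (2 * Num.sqrt (f x))^-1.
  by case: ds => d <-; rewrite deriveE.
by rewrite -[_ *: _]/(_ * _) mulrC invfM.
Qed.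

Lemma Ck_on_sqrt k (U : set V) (f : V -> R) : open U -> (forall x, U x -> 0 < f x) ->
  Ck_on k U f -> Ck_on k U (fun x => Num.sqrt (f x)).
Proof.
move=> oU f0; elim: k => [|k IH].
  move=> cf x Ux; apply: continuous_comp; first exact: cf.
  exact: sqrt_continuous.
move=> /[dup] /Ck_onS Cf [df cf]; split=> [x Ux|v].
  exact: (is_derive_sqrt_comp 0 (f0 _ Ux) (df _ Ux)).1.
have Cs := IH Cf.
have s0 x : U x -> Num.sqrt (f x) != 0 by move=> Ux; rewrite gt_eqF // sqrtr_gt0 f0.
have Cv := Ck_onV oU s0 Cs.
have := Ck_onM oU (Ck_onM oU (@smooth_on_cst _ _ (2^-1 : R) k) Cv) (cf v).
apply: Ck_on_ext => // x Ux.
by rewrite (is_derive_sqrt_comp v (f0 _ Ux) (df _ Ux)).2.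
Qed.

Lemma smooth_on_sqrt (U : set V) (f : V -> R) : open U -> (forall x, U x -> 0 < f x) ->
  smooth_on U f -> smooth_on U (fun x => Num.sqrt (f x)).
Proof. by move=> oU f0 sf k; exact: Ck_on_sqrt. Qed.

End calculus.

Section calculus_vector.
Context {R : realType} {V : normedModType R}.

Lemma derive_comp_affine (V' W : normedModType R) (A L : V -> V') (F : V' -> W) x v :
  (forall h v x, A (h *: v + x) = h *: L v + A x) ->
  'D_v (fun y => F (A y)) x = 'D_(L v) F (A x).
Proof.
move=> AL; rewrite /derive /=.
suff -> : (fun h : R => h^-1 *: (F (A (h *: v + x)) - F (A x))) =
  fun h => h^-1 *: (F (h *: L v + A x) - F (A x)) by [].
by apply/funext => h; rewrite AL.
Qed.

(** Only precomposition with affine maps A (slices and projections of a product)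
is used; there the chain rule is an identity of difference quotients, with the
direction transported by the linear part L, so every order is handled alike. *)
Lemma smooth_on_comp_affine (V' W : normedModType R) (U : set V') (A L : V -> V')
    (F : V' -> W) :
  (forall h v x, A (h *: v + x) = h *: L v + A x) -> (forall x, differentiable A x) ->
  smooth_on U F -> smooth_on (A @^-1` U) (fun y => F (A y)).
Proof.
move=> AL dA sF k; elim: k F sF => [|k IH] F sF.
  move=> x Ux; apply: (@continuous_comp _ _ _ A F); last exact: (sF 0%N).
  exact: differentiable_continuous.
split=> [x Ux|v].
  apply: (@differentiable_comp _ _ _ _ A F) => //.
  exact: (smooth_on_differentiable sF).
rewrite (_ : (fun x => 'D_v _ x) = fun x => 'D_(L v) F (A x)).
  exact: (IH (fun x => 'D_(L v) F x) (smooth_on_derive (L v) sF)).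
by apply/funext => x; apply: derive_comp_affine.
Qed.

Lemma Ck_on_coord n k (U : set V) (F : V -> 'rV[R]_n) i : open U ->
  Ck_on k U F -> Ck_on k U (fun x => F x 0 i).
Proof.
move=> oU; elim: k F => [|k IH] F.
  by move=> cF x Ux; apply: (@continuous_comp _ _ _ F (fun M : 'rV[R]_n => M 0 i)); [exact: cF|exact: coord_continuous].
move=> [dF cF]; split=> [x Ux|v].
  apply: (@differentiable_comp _ _ _ _ F (fun M : 'rV[R]_n => M 0 i)); first exact: dF.
  exact: differentiable_coord.
apply: Ck_on_ext (IH _ (cF v)) => // x Ux.
by rewrite derive_mx ?mxE //; apply: diff_derivable; exact: dF.
Qed.

Lemma smooth_on_coord n (U : set V) (F : V -> 'rV[R]_n) i : open U ->
  smooth_on U F -> smooth_on U (fun x => F x 0 i).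
Proof. by move=> oU sF k; exact: Ck_on_coord. Qed.

Lemma smooth_onZl (W : normedModType R) (U : set V) (f : V -> R) (a : W) : open U ->
  smooth_on U f -> smooth_on U (fun x => f x *: a).
Proof.
move=> oU sf k; elim: k f sf => [|k IH] f sf.
  move=> x Ux; apply: (@continuous_comp _ _ _ f ( *:%R^~ a)); first exact: (sf 0%N).
  exact: scalel_continuous.
split=> [x Ux|v].
  by apply: differentiableZl; exact: smooth_on_differentiable Ux.
apply: Ck_on_ext (IH _ (smooth_on_derive v sf)) => // x Ux.
have df : differentiable f x by exact: smooth_on_differentiable Ux.
by rewrite [RHS]deriveE ?diffZl //; [rewrite deriveE|exact: differentiableZl].
Qed.

Lemma smooth_on_row n (U : set V) (F : V -> 'rV[R]_n) : open U ->
  (forall i, smooth_on U (fun x => F x 0 i)) -> smooth_on U F.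
Proof.
move=> oU sF.
have -> : F = fun x => \sum_(i <- index_enum 'I_n) F x 0 i *: 'e_i.
  by apply/funext => x; rewrite [LHS]row_sum_delta.
elim: (index_enum _) => [|i s IH].
  rewrite (_ : (fun x => _) = fun x => 0); first exact: smooth_on_cst.
  by apply/funext => x; rewrite big_nil.
rewrite (_ : (fun x => _) = fun x => F x 0 i *: 'e_i + \sum_(j <- s) F x 0 j *: 'e_j).
  by apply: smooth_onD => //; exact: smooth_onZl.
by apply/funext => x; rewrite big_cons.
Qed.

End calculus_vector.

Lemma smooth_on_coordinate (R : realType) k (U : set 'rV[R]_k) i : open U ->
  smooth_on U (fun z : 'rV[R]_k => z 0 i).
Proof. by move=> oU; apply: smooth_on_coord => //; exact: smooth_on_id. Qed.

(** * Mixed partial derivatives and a Taylor bound *)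

Section mixed_partials.
Context {R : realType} {V : normedModType R}.
Implicit Types (f : V -> R) (a u v x : V).

Lemma is_derive_line f a u (s : R) : derivable f (a + s *: u) u ->
  is_derive s (1 : R) (fun s : R => f (a + s *: u)) ('D_u f (a + s *: u)).
Proof.
move=> df.
have E : (fun h : R => h^-1 *: (f (a + (h *: 1 + s) *: u) - f (a + s *: u))) =
         (fun h : R => h^-1 *: (f (h *: u + (a + s *: u)) - f (a + s *: u))).
  apply/funext => h; congr (_ *: (f _ - _)).
  by rewrite [h *: 1]mulr1 scalerDl addrCA.
split; last by rewrite /derive /= E.
by rewrite /derivable /= E.
Qed.

Lemma MVT_line f a u (h : R) : 0 < h ->
  (forall s, 0 <= s <= h -> derivable f (a + s *: u) u) ->
  exists2 c, 0 <= c <= h & f (a + h *: u) - f a = h * 'D_u f (a + c *: u).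
Proof.
move=> h0 df.
have [|||c] := @MVT R (fun s => f (a + s *: u)) (fun s => 'D_u f (a + s *: u)) 0 h.
- by [].
- move=> s; rewrite in_itv /= => /andP[s0 sh]; apply: is_derive_line.
  by apply: df; rewrite !ltW.
- apply: derivable_within_continuous => s; rewrite in_itv /= => sI.
  by have [] := is_derive_line (df _ sI).
- rewrite in_itv /= => /andP[c0 ch]; rewrite scale0r addr0 subr0 => E.
  by exists c; rewrite ?ltW // E mulrC.
Qed.

Lemma derive_translate f w y u : 'D_u (fun z => f (z + w)) y = 'D_u f (y + w).
Proof.
rewrite /derive /=.
suff -> : (fun h : R => h^-1 *: (f (h *: u + y + w) - f (y + w))) =
          (fun h : R => h^-1 *: (f (h *: u + (y + w)) - f (y + w))) by [].
by apply/funext => h; rewrite addrA.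
Qed.

Lemma derivable_translate f w y u :
  derivable f (y + w) u -> derivable (fun z => f (z + w)) y u.
Proof.
rewrite /derivable /=.
suff -> : (fun h : R => h^-1 *: (f (h *: u + y + w) - f (y + w))) =
          (fun h : R => h^-1 *: (f (h *: u + (y + w)) - f (y + w))) by [].
by apply/funext => h; rewrite addrA.
Qed.

(** Mean value theorem twice: along u for the increment of f in direction v, then
along v for the derivative D_u f. *)
Lemma second_difference f u v x (U : set V) (e : R) : open U -> U x ->
  smooth_on U f -> 0 < e ->
  \forall h \near 0^'+, exists2 d : R,
    `|d - 'D_v (fun y => 'D_u f y) x| < e &
    f (x + h *: u + h *: v) - f (x + h *: u) - (f (x + h *: v) - f x) = h * (h * d).
Proof.
move=> oU Ux sf e0.
have sDu := smooth_on_derive u sf.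
have sDD := smooth_on_derive v sDu.
have : \forall y \near x, U y /\ `|'D_v (fun y => 'D_u f y) y - 'D_v (fun y => 'D_u f y) x| < e.
  near=> y; split; first by near: y; exact: open_nbhs_nbhs.
  rewrite distrC; near: y.
  have /cvgrPdist_lt := sDD 0%N x Ux; exact.
move=> /nbhs_ballP[r /= r0 rU].
pose M := `|u| + `|v| + 1.
have M0 : 0 < M by rewrite ltr_wpDl ?addr_ge0.
have inU s t h : 0 <= s <= h -> 0 <= t <= h -> h < r / M ->
    U (x + s *: u + t *: v) /\
    `|'D_v (fun y => 'D_u f y) (x + s *: u + t *: v) - 'D_v (fun y => 'D_u f y) x| < e.
  move=> /andP[s0 sh] /andP[t0 th] hr; apply: rU.
  rewrite -ball_normE /= -addrA opprD addNKr normrN.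
  apply: le_lt_trans (ler_normD _ _) _; rewrite !normrZ !ger0_norm //.
  apply: (@le_lt_trans _ _ (h * M)); last by rewrite -ltr_pdivlMr.
  rewrite !mulrDr mulr1 -[leLHS]addr0 !lerD ?ler_wpM2r //.
  exact: le_trans s0 sh.
near=> h.
have h0 : 0 < h by near: h; exact: nbhs_right_gt.
have hr : h < r / M by near: h; apply: nbhs_right_lt; rewrite divr_gt0.
have h0h : 0 <= h <= h by rewrite ltW /=.
have z0h : 0 <= (0 : R) <= h by rewrite lexx ltW.
have [|c ch E1] := @MVT_line (fun y => f (y + h *: v) - f y) x u h h0.
  move=> s sh; apply: derivableB; last first.
    have [Us _] := inU s 0 h sh z0h hr; rewrite scale0r addr0 in Us.
    exact: smooth_on_derivable Us.
  apply: derivable_translate.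
  have [Us _] := inU s h h sh h0h hr.
  exact: smooth_on_derivable Us.
have [|d dh E2] := @MVT_line (fun y => 'D_u f y) (x + c *: u) v h h0.
  move=> s sh; have [Us _] := inU c s h ch sh hr.
  exact: smooth_on_derivable Us.
exists ('D_v (fun y => 'D_u f y) (x + c *: u + d *: v)).
  by have [] := inU c d h ch dh hr.
rewrite E1 -E2; congr (_ * _).
rewrite deriveB; first by rewrite derive_translate.
  apply: derivable_translate; have [Us _] := inU c h h ch h0h hr.
  exact: smooth_on_derivable Us.
have [Us _] := inU c 0 h ch z0h hr; rewrite scale0r addr0 in Us.
exact: smooth_on_derivable Us.
Unshelve. all: by end_near. Qed.

(** The second difference is symmetric in u and v and, divided by h^2, is close to
either of the two mixed derivatives. *)
Lemma derive_comm f u v x (U : set V) : open U -> U x -> smooth_on U f ->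
  'D_v (fun y => 'D_u f y) x = 'D_u (fun y => 'D_v f y) x.
Proof.
move=> oU Ux sf; apply/eqP; rewrite -subr_eq0 -normr_le0.
apply/ler_addgt0Pr => e e0; rewrite add0r.
have e2 : 0 < e / 2 by rewrite divr_gt0.
near (0:R)^'+ => h.
have h0 : 0 < h by near: h; exact: nbhs_right_gt.
have [d de Ed] : exists2 d : R,
    `|d - 'D_v (fun y => 'D_u f y) x| < e / 2 &
    f (x + h *: u + h *: v) - f (x + h *: u) - (f (x + h *: v) - f x) = h * (h * d).
  by near: h; exact: second_difference oU Ux sf e2.
have [d' de' Ed'] : exists2 d : R,
    `|d - 'D_u (fun y => 'D_v f y) x| < e / 2 &
    f (x + h *: v + h *: u) - f (x + h *: v) - (f (x + h *: u) - f x) = h * (h * d).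
  by near: h; exact: second_difference oU Ux sf e2.
have hn : h != 0 by rewrite gt_eqF.
have dd : d = d'.
  apply: (mulfI hn); apply: (mulfI hn); rewrite -Ed -Ed'.
  by rewrite [x + _ + _]addrAC; ring.
rewrite -dd in de'.
rewrite distrC in de; rewrite -(subrKA d) (splitr e).
apply: le_trans (ler_normD _ _) _; rewrite ltW //.
exact: ltrD.
Unshelve. all: by end_near. Qed.

End mixed_partials.

Section taylor.
Context {R : realType}.

Lemma is_derive1_MVT (f df : R -> R) (a b : R) : a != b ->
  (forall s, Num.min a b <= s <= Num.max a b -> is_derive s (1 : R) f (df s)) ->
  exists2 c, Num.min a b <= c <= Num.max a b & f b - f a = df c * (b - a).
Proof.
have key (x y : R) : x < y -> (forall s, x <= s <= y -> is_derive s (1 : R) f (df s)) ->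
    exists2 c, x <= c <= y & f y - f x = df c * (y - x).
  move=> xy H; have [||c] := @MVT R f df x y xy.
  - by move=> s; rewrite in_itv /= => /andP[s0 sh]; apply: H; rewrite !ltW.
  - by apply: derivable_within_continuous => s; rewrite in_itv /= => /H[].
  - by rewrite in_itv /= => /andP[c0 ch] E; exists c; rewrite ?ltW.
case: ltgtP => // ab _; first exact: key.
move=> /(key _ _ ab)[c cI E]; exists c => //.
by rewrite -opprB E -mulrN opprB.
Qed.

Lemma taylor1_bound (f df ddf : R -> R) (a d M : R) :
  (forall s, `|s| <= d -> is_derive s (1 : R) f (df s)) ->
  (forall s, `|s| <= d -> is_derive s (1 : R) df (ddf s)) ->
  (forall s, `|s| <= d -> `|ddf s| <= M) ->
  forall h, `|a| <= d -> `|a + h| <= d -> `|f (a + h) - f a - h * df a| <= M * h ^+ 2.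
Proof.
move=> d1 d2 bM h ad ahd.
have [->|h0] := eqVneq h 0.
  by rewrite addr0 subrr mul0r subr0 normr0 expr0n mulr0.
have btw (x y s : R) : `|x| <= d -> `|y| <= d -> Num.min x y <= s <= Num.max x y -> `|s| <= d.
  rewrite !ler_norml; case: (ltgtP x y) => xy /andP[? ?] /andP[? ?] /andP[? ?];
    apply/andP; split; lra.
have aah : a != a + h by rewrite -subr_eq0 opprD addrA subrr sub0r oppr_eq0.
have [|c cI Ec] := @is_derive1_MVT f df a (a + h) aah.
  by move=> s /(btw _ _ _ ad ahd); exact: d1.
have cd := btw _ _ _ ad ahd cI.
rewrite Ec [a + h - a]addrAC subrr add0r mulrC -mulrBr.
have ca : `|c - a| <= `|h|.
  move: cI; rewrite ler_norml; case: (ltgtP a (a + h)) => ah /andP[? ?].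
  - have h0' : 0 < h by lra.
    rewrite gtr0_norm //; apply/andP; split; lra.
  - have h0' : h < 0 by lra.
    rewrite ltr0_norm //; apply/andP; split; lra.
  - rewrite -ah eqxx in aah; by [].
have [->|ac] := eqVneq a c.
  by rewrite subrr mulr0 normr0 mulr_ge0 ?sqr_ge0 // (le_trans _ (bM a ad)).
have [|c' c'I ->] := @is_derive1_MVT df ddf a c ac.
  by move=> s /(btw _ _ _ ad cd); exact: d2.
have c'd := btw _ _ _ ad cd c'I.
have -> : M * h ^+ 2 = `|h| * (M * `|h|) by rewrite -[h ^+ 2]real_normK ?num_real //; ring.
by rewrite !normrM; apply: ler_pM; rewrite ?mulr_ge0 // ler_pM // bM.
Qed.

End taylor.

(** * Iterated integrals of dominated continuous functions *)

Section weight.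
Context {R : realType}.

(** The volume density (2r/(1+|u|^2))^m of the stereographic chart is not a product
of functions of one variable; it is dominated by this product, which an iterated
integral can integrate one variable at a time. *)
Definition cauchy_weight (n : nat) (u : 'rV[R]_n) : R := \prod_(i < n) (1 + u 0 i ^+ 2)^-1.

Lemma row_mx_cons0 n (x : R) (v : 'rV[R]_n) :
  (row_mx (x%:M : 'rV[R]_1) v : 'rV[R]_n.+1) 0 ord0 = x.
Proof.
have -> : (ord0 : 'I_n.+1) = lshift n (ord0 : 'I_1) by exact: val_inj.
by rewrite (@row_mxEl _ _ 1 n) mxE eqxx mulr1n.
Qed.

Lemma row_mx_consS n (x : R) (v : 'rV[R]_n) j :
  (row_mx (x%:M : 'rV[R]_1) v : 'rV[R]_n.+1) 0 (lift ord0 j) = v 0 j.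
Proof.
have -> : (lift ord0 j : 'I_n.+1) = rshift 1 j by exact: val_inj.
by rewrite (@row_mxEr _ _ 1 n).
Qed.

Lemma cauchy_weight_cons n (x : R) (v : 'rV[R]_n) :
  cauchy_weight (row_mx (x%:M : 'rV[R]_1) v : 'rV[R]_n.+1) = (1 + x ^+ 2)^-1 * cauchy_weight v.
Proof.
rewrite /cauchy_weight big_ord_recl row_mx_cons0; congr (_ * _).
by apply: eq_bigr => j _; rewrite row_mx_consS.
Qed.

Lemma cauchy_factor_ge0 (x : R) : 0 <= (1 + x ^+ 2)^-1.
Proof. by rewrite invr_ge0 addr_ge0 ?sqr_ge0. Qed.

Lemma cauchy_factor_le1 (x : R) : (1 + x ^+ 2)^-1 <= 1.
Proof. by rewrite invf_le1 ?ltr_pwDl ?sqr_ge0 // lerDl sqr_ge0. Qed.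

Lemma cauchy_weight_ge0 n (u : 'rV[R]_n) : 0 <= cauchy_weight u.
Proof. by apply: prodr_ge0 => i _; exact: cauchy_factor_ge0. Qed.

Lemma integrable_cauchy :
  (@lebesgue_measure R).-integrable setT (EFin \o (fun x : R => (1 + x ^+ 2)^-1)).
Proof.
have cf : continuous (fun x : R => (1 + x ^+ 2)^-1) by move=> x; exact: continuous_oneDsqrV.
apply/integrableP; split.
  by apply/measurable_EFinP; exact: continuous_measurable_fun.
under eq_integral => x _.
  rewrite /= ger0_norm ?cauchy_factor_ge0 //.
  over.
rewrite (@ge0_symfun_integralT R (fun x => (1 + x ^+ 2)^-1)) //.
- rewrite (_ : [set x | _] = `[0, +oo[%classic); last first.
    by apply/seteqP; split => x/=; rewrite in_itv/= andbT.
  by rewrite integral0y_oneDsqr -EFinM ltry.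
- by move=> x; exact: cauchy_factor_ge0.
- by move=> x /=; rewrite sqrrN.
Qed.

Lemma continuous_row (T : topologicalType) n (G : T -> 'rV[R]_n) :
  (forall i, continuous (fun x => G x 0 i)) -> continuous G.
Proof.
move=> cG x A [P nP sPA].
have : \forall y \near x, forall i, P 0 i (G y 0 i).
  by apply: filter_forall => i; apply: (cG i x); exact: nP.
by apply: filterS => y Py; apply: sPA => i j; rewrite (ord1 i).
Qed.

Lemma continuous_cons_l n (v : 'rV[R]_n) :
  continuous (fun x : R => row_mx (x%:M : 'rV[R]_1) v : 'rV[R]_n.+1).
Proof.
apply: continuous_row => i; case: (unliftP ord0 i) => [j|] ->.
  rewrite (_ : (fun x => _) = fun x => v 0 j); first exact: cst_continuous.
  by apply/funext => x; rewrite row_mx_consS.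
rewrite (_ : (fun x => _) = id); first by move=> x.
by apply/funext => x; rewrite row_mx_cons0.
Qed.

Lemma continuous_cons_r n (x : R) :
  continuous (fun v : 'rV[R]_n => row_mx (x%:M : 'rV[R]_1) v : 'rV[R]_n.+1).
Proof.
apply: continuous_row => i; case: (unliftP ord0 i) => [j|] ->.
  rewrite (_ : (fun v : 'rV[R]_n => _) = fun v : 'rV[R]_n => v 0 j); first exact: coord_continuous.
  by apply/funext => v; rewrite row_mx_consS.
rewrite (_ : (fun v : 'rV[R]_n => _) = fun v => x); first exact: cst_continuous.
by apply/funext => v; rewrite row_mx_cons0.
Qed.

(** Continuity is what makes the inner integrals measurable in the outer variable,
and the bound makes them integrable: the class is stable under slicing. *)
Definition cauchy_bounded n (C : R) (F : 'rV[R]_n -> R) : Prop :=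
  continuous F /\ forall u, `|F u| <= C * cauchy_weight u.

Definition cauchy_mass : R := \int[lebesgue_measure]_x (1 + x ^+ 2)^-1.

Lemma cauchy_bounded_slice n C (F : 'rV[R]_n.+1 -> R) (x : R) :
  cauchy_bounded C F ->
  cauchy_bounded (C * (1 + x ^+ 2)^-1) (fun v : 'rV[R]_n => F (row_mx (x%:M : 'rV[R]_1) v)).
Proof.
move=> [cF bF]; split=> [v|v].
  apply: (@continuous_comp _ _ _ (fun v : 'rV[R]_n => row_mx (x%:M : 'rV[R]_1) v : 'rV[R]_n.+1) F).
    exact: continuous_cons_r.
  exact: cF.
by rewrite -mulrA -cauchy_weight_cons.
Qed.

(** The weight equals 1 at the origin. *)
Lemma cauchy_bounded_C_ge0 n C (F : 'rV[R]_n -> R) : cauchy_bounded C F -> 0 <= C.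
Proof.
move=> [_ /(_ 0)].
rewrite (_ : cauchy_weight 0 = 1) ?mulr1; first exact: le_trans.
by rewrite /cauchy_weight big1 // => i _; rewrite mxE expr0n addr0 invr1.
Qed.

Lemma integrable_cauchy_dominated (f : R -> R) C : continuous f ->
  (forall x, `|f x| <= C * (1 + x ^+ 2)^-1) ->
  (@lebesgue_measure R).-integrable setT (EFin \o f).
Proof.
move=> cf bf.
have iC : (@lebesgue_measure R).-integrable setT (EFin \o (fun x : R => C * (1 + x ^+ 2)^-1)).
  have := integrableZl measurableT C integrable_cauchy.
  by congr (_.-integrable _ _); apply/funext => x /=; rewrite EFinM.
apply: le_integrable iC => //.
  by apply/measurable_EFinP; exact: continuous_measurable_fun.
move=> x _ /=; rewrite lee_fin; apply: le_trans (bf x) _; exact: ler_norm.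
Qed.

(** The two properties are proved by a simultaneous induction: the bound in dimension
n+1 needs measurability of the inner integral, which follows from continuity in
dimension n; continuity in dimension n+1 is dominated convergence, with the bound
in dimension n as the dominating function. *)
Definition Rn_integral_regular n : Prop :=
  (forall C (F : 'rV[R]_n -> R), cauchy_bounded C F ->
     `|Rn_integral F| <= C * cauchy_mass ^+ n) /\
  (forall C (G : R -> 'rV[R]_n -> R), (forall x, cauchy_bounded C (G x)) ->
     (forall v, continuous (G^~ v)) -> continuous (fun x => Rn_integral (G x))).

Lemma slice_integral_bound n C (F : 'rV[R]_n.+1 -> R) x : Rn_integral_regular n ->
  cauchy_bounded C F ->
  `|Rn_integral (fun v : 'rV[R]_n => F (row_mx (x%:M : 'rV[R]_1) v))|
    <= C * cauchy_mass ^+ n * (1 + x ^+ 2)^-1.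
Proof.
move=> [IHb _] bF; rewrite mulrAC; exact: IHb (cauchy_bounded_slice x bF).
Qed.

Lemma slice_cauchy_bounded n C (F : 'rV[R]_n.+1 -> R) x : cauchy_bounded C F ->
  cauchy_bounded C (fun v : 'rV[R]_n => F (row_mx (x%:M : 'rV[R]_1) v)).
Proof.
move=> bF; have [? bs] := cauchy_bounded_slice x bF; split => // u; apply: le_trans (bs u) _.
rewrite ler_wpM2r ?cauchy_weight_ge0 // ler_piMr ?cauchy_factor_le1 //.
exact: cauchy_bounded_C_ge0 bF.
Qed.

Lemma slice_integral_integrable n C (F : 'rV[R]_n.+1 -> R) : Rn_integral_regular n ->
  cauchy_bounded C F ->
  (@lebesgue_measure R).-integrable setT
    (EFin \o (fun x : R => Rn_integral (fun v : 'rV[R]_n => F (row_mx (x%:M : 'rV[R]_1) v)))).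
Proof.
move=> IH bF; apply: (@integrable_cauchy_dominated _ (C * cauchy_mass ^+ n)); last first.
  by move=> x; exact: slice_integral_bound.
case: IH => _ IHc; apply: (IHc C) => [x|v]; first exact: slice_cauchy_bounded.
move=> x; apply: (@continuous_comp _ _ _ (fun x => row_mx (x%:M : 'rV[R]_1) v : 'rV[R]_n.+1) F).
  exact: continuous_cons_l.
by case: bF => + _; exact.
Qed.

Lemma Rn_integralP n : Rn_integral_regular n.
Proof.
elim: n => [|n IH].
  split=> [C F [_ /(_ 0)]|C G _ cG /=]; last exact: cG.
  by rewrite /cauchy_weight big_ord0 expr0 /=.
have iC (C : R) : (@lebesgue_measure R).-integrable setT (EFin \o (fun x : R => C * (1 + x ^+ 2)^-1)).
  apply: (@integrable_cauchy_dominated _ `|C|).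
    by move=> x; apply: cvgM; [exact: cvg_cst|exact: continuous_oneDsqrV].
  by move=> x; rewrite normrM (ger0_norm (cauchy_factor_ge0 x)).
split=> [C F bF /=|C G bG cG /=].
  apply: le_trans (le_normr_Rintegral _ _) _ => //; first exact: slice_integral_integrable IH bF.
  rewrite exprSr mulrA -RintegralZl //; last exact: integrable_cauchy.
  apply: le_Rintegral => //.
  - have := slice_integral_integrable IH bF => /integrable_abse; exact.
  - by move=> x _; exact: slice_integral_bound.
move=> a.
have := @continuity_under_integral R _ _ (@lebesgue_measure R)
  (fun x y => Rn_integral (fun v : 'rV[R]_n => G x (row_mx (y%:M : 'rV[R]_1) v))) setT measurableT
  (a - 1) (a + 1) _ _ (fun y => C * cauchy_mass ^+ n * (1 + y ^+ 2)^-1).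
apply.
- by move=> x _; exact: slice_integral_integrable IH (bG x).
- apply: aeW => y _ x _; case: (IH) => _ IHc; apply: (IHc C).
    by move=> {}x; exact: slice_cauchy_bounded.
  by move=> v; exact: cG.
- exact: iC.
- by move=> x _; apply: aeW => y _; exact: slice_integral_bound.
- by rewrite inE /= in_itv /= ltrBlDr ltrDl ltr01.
Qed.

Lemma le_Rn_integral n C (F : 'rV[R]_n -> R) :
  cauchy_bounded C F -> `|Rn_integral F| <= C * cauchy_mass ^+ n.
Proof. by have [+ _] := Rn_integralP n; exact. Qed.

Lemma Rn_integral_ge0 n (F : 'rV[R]_n -> R) : (forall u, 0 <= F u) -> 0 <= Rn_integral F.
Proof.
elim: n F => [|n IH] F F0 /=; first exact: F0.
by apply: Rintegral_ge0 => x _; exact: IH.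
Qed.

Lemma Rn_integral_linear n a C D (F G : 'rV[R]_n -> R) :
  cauchy_bounded C F -> cauchy_bounded D G ->
  Rn_integral (fun u => a * F u + G u) = a * Rn_integral F + Rn_integral G.
Proof.
elim: n F G C D => [//|n IH] F G C D bF bG /=.
have iF := slice_integral_integrable (Rn_integralP n) bF.
have iG := slice_integral_integrable (Rn_integralP n) bG.
rewrite -RintegralZl // -RintegralD //; last first.
  have := integrableZl measurableT a iF.
  by congr (_.-integrable _ _); apply/funext => x /=; rewrite EFinM.
apply: eq_Rintegral => x _.
exact: IH (slice_cauchy_bounded x bF) (slice_cauchy_bounded x bG).
Qed.

Lemma cauchy_bounded_linear n a C D (F G : 'rV[R]_n -> R) :
  cauchy_bounded C F -> cauchy_bounded D G ->
  cauchy_bounded (`|a| * C + D) (fun u => a * F u + G u).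
Proof.
move=> [cF bF] [cG bG]; split=> [u|u].
  apply: (@continuousD _ _ _ (fun u => a * F u) G u); last exact: cG.
  by apply: (@continuousM _ _ (fun=> a) F u); [exact: cst_continuous|exact: cF].
apply: le_trans (ler_normD _ _) _; rewrite mulrDl lerD // normrM -mulrA.
by rewrite ler_wpM2l.
Qed.

(** The error of the difference quotient is 1/s times the integral of the first-order
Taylor remainder, which is at most C s^2 times the weight; only linearity and
boundedness of the iterated integral are involved. *)
Lemma is_derive_Rn_integral n (h dh ddh : R -> 'rV[R]_n -> R) (a d C : R) :
  `|a| < d ->
  (forall t, `|t| <= d -> cauchy_bounded C (h t)) ->
  (forall t, `|t| <= d -> cauchy_bounded C (dh t)) ->
  (forall t u, `|t| <= d -> is_derive t (1 : R) (h^~ u) (dh t u)) ->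
  (forall t u, `|t| <= d -> is_derive t (1 : R) (dh^~ u) (ddh t u)) ->
  (forall t u, `|t| <= d -> `|ddh t u| <= C * cauchy_weight u) ->
  is_derive a (1 : R) (fun t => Rn_integral (h t)) (Rn_integral (dh a)).
Proof.
move=> ad bh bdh d1 d2 b2.
have C0 : 0 <= C by exact: cauchy_bounded_C_ge0 (bh _ (ltW ad)).
pose M := `|C * cauchy_mass ^+ n| + 1.
have M0 : 0 < M by rewrite ltr_wpDl.
suff H : (fun s : R => s^-1 *: (Rn_integral (h (s *: (1 : R) + a)) - Rn_integral (h a))) @ 0^'
    --> Rn_integral (dh a).
  by split; [apply/cvg_ex; eexists; exact: H|exact: cvg_lim H].
apply/cvgrPdist_le => e e0; near=> s.
have s0 : s != 0 by near: s; exact: nbhs_dnbhs_neq.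
have sd : `|s| < d - `|a| by near: s; apply: dnbhs0_lt; rewrite subr_gt0.
have se : `|s| < e / M by near: s; apply: dnbhs0_lt; rewrite divr_gt0.
have sad : `|a + s| <= d.
  by apply: le_trans (ler_normD _ _) _; rewrite addrC -lerBrDr ltW.
rewrite [s *: 1]mulr1 (addrC s).
have E : Rn_integral (fun u => (- s) * dh a u + ((-1) * h a u + h (a + s) u)) =
    (- s) * Rn_integral (dh a) + ((-1) * Rn_integral (h a) + Rn_integral (h (a + s))).
  have b1 := bh _ (ltW ad); have b1' := bh _ sad.
  rewrite (Rn_integral_linear _ (bdh _ (ltW ad)) (cauchy_bounded_linear (-1) b1 b1')).
  by rewrite (Rn_integral_linear _ b1 b1').
have B : cauchy_bounded (C * s ^+ 2) (fun u => (- s) * dh a u + ((-1) * h a u + h (a + s) u)).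
  have b1 := bh _ (ltW ad); have b1' := bh _ sad.
  have [cB _] := cauchy_bounded_linear (- s) (bdh _ (ltW ad)) (cauchy_bounded_linear (-1) b1 b1').
  split => // u.
  have -> : - s * dh a u + (- 1 * h a u + h (a + s) u) = h (a + s) u - h a u - s * dh a u by ring.
  rewrite mulrAC.
  exact: (@taylor1_bound R (h^~ u) (dh^~ u) (ddh^~ u) a d _ (fun t td => d1 t u td)
    (fun t td => d2 t u td) (fun t td => b2 t u td) s (ltW ad) sad).
have := le_Rn_integral B; rewrite E => LE.
(* the integral of the remainder divided by s *)
have -> : Rn_integral (dh a) - s^-1 *: (Rn_integral (h (a + s)) - Rn_integral (h a)) =
   - s^-1 * ((- s) * Rn_integral (dh a) + ((-1) * Rn_integral (h a) + Rn_integral (h (a + s)))).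
  by rewrite -[_ *: _]/(_ * _); field.
rewrite normrM normrN normfV ler_pdivrMl ?normr_gt0 //.
apply: le_trans LE _.
rewrite mulrAC -[s ^+ 2]real_normK ?num_real // expr2 mulrA mulrC.
rewrite ler_wpM2l //.
apply: (@le_trans _ _ (M * `|s|)).
  by rewrite ler_wpM2r // /M (le_trans (ler_norm _)) // lerDl.
by rewrite mulrC -ler_pdivlMr // ltW.
Unshelve. all: by end_near. Qed.

End weight.

(** * Euclidean geometry and derivatives of the tangential projection *)

Section euclid.
Context {R : realType} {n : nat}.
Implicit Types u v w x y : 'rV[R]_n.

Lemma dotE u v : dot u v = \sum_i u 0 i * v 0 i.
Proof. by rewrite /dot mxE; apply: eq_bigr => i _; rewrite mxE. Qed.

Lemma dotC u v : dot u v = dot v u.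
Proof. by rewrite !dotE; apply: eq_bigr => i _; rewrite mulrC. Qed.

Lemma dotDl u v w : dot (u + v) w = dot u w + dot v w.
Proof. by rewrite /dot mulmxDl mxE. Qed.

Lemma dotZl a u w : dot (a *: u) w = a * dot u w.
Proof. by rewrite /dot -scalemxAl mxE. Qed.

Lemma dotNl u w : dot (- u) w = - dot u w.
Proof. by rewrite -scaleN1r dotZl mulN1r. Qed.

Lemma dotDr u v w : dot w (u + v) = dot w u + dot w v.
Proof. by rewrite dotC dotDl !(dotC w). Qed.

Lemma dotZr a u w : dot w (a *: u) = a * dot w u.
Proof. by rewrite dotC dotZl (dotC w). Qed.

Lemma dotNr u w : dot w (- u) = - dot w u.
Proof. by rewrite dotC dotNl (dotC w). Qed.

Lemma dot0l u : dot 0 u = 0.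
Proof. by rewrite /dot mul0mx mxE. Qed.

Definition dotP := (dotDl, dotDr, dotNl, dotNr, dotZl, dotZr).

Lemma dot_ge0 u : 0 <= dot u u.
Proof. by rewrite dotE sumr_ge0 // => i _; rewrite -expr2 sqr_ge0. Qed.

Lemma dot_eq0 u : (dot u u == 0) = (u == 0).
Proof.
apply/eqP/eqP => [|->]; last exact: dot0l.
rewrite dotE => /eqP; rewrite psumr_eq0 => [|i _]; last by rewrite -expr2 sqr_ge0.
move=> /allP u0; apply/rowP => i; rewrite mxE.
by have := u0 i (mem_index_enum _); rewrite /= mulf_eq0 orbb => /eqP.
Qed.

Lemma dot_gt0 u : (0 < dot u u) = (u != 0).
Proof. by rewrite lt_neqAle dot_ge0 eq_sym dot_eq0 andbT. Qed.

Lemma enorm_sqr u : enorm u ^+ 2 = dot u u.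
Proof. by rewrite sqr_sqrtr // dot_ge0. Qed.

Lemma enorm_ge0 u : 0 <= enorm u.
Proof. exact: sqrtr_ge0. Qed.

Lemma enorm_gt0 u : (0 < enorm u) = (u != 0).
Proof. by rewrite sqrtr_gt0 dot_gt0. Qed.

Lemma enormZ a u : 0 <= a -> enorm (a *: u) = a * enorm u.
Proof.
move=> a0; rewrite /enorm dotZl dotZr mulrA -expr2 sqrtrM ?sqr_ge0 //.
by rewrite sqrtr_sqr ger0_norm.
Qed.

Lemma is_derive_coord {V : normedModType R} (F : V -> 'rV[R]_n) (x v : V) dF :
  is_derive x v F dF <-> forall i, is_derive x v (fun z => F z 0 i) (dF 0 i).
Proof.
split=> [[dd <-] i|H].
  split; last by rewrite derive_mx // mxE.
  by move: dd => /derivable_mxP; apply.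
have dd : derivable F x v by apply/derivable_mxP => i j; rewrite (ord1 i); case: (H j).
split=> //; rewrite derive_mx //; apply/rowP => i; rewrite mxE.
by case: (H i).
Qed.

Lemma is_derive_dot {V : normedModType R} (F G : V -> 'rV[R]_n) (x v : V) dF dG :
  is_derive x v F dF -> is_derive x v G dG ->
  is_derive x v (fun z => dot (F z) (G z)) (dot dF (G x) + dot (F x) dG).
Proof.
move=> /is_derive_coord HF /is_derive_coord HG.
have -> : (fun z => dot (F z) (G z)) = \sum_(i < n) ((fun z => F z 0 i) * (fun z => G z 0 i)).
  by apply/funext => z; rewrite dotE fct_sumE.
apply: is_derive_eq; rewrite !dotE -big_split; apply: eq_bigr => i _ /=.
by rewrite -![_ *: _]/(_ * _) addrC (mulrC (G x 0 i)).
Qed.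

Lemma is_derive_scale {V : normedModType R} (f : V -> R) (F : V -> 'rV[R]_n) (x v : V) df dF :
  is_derive x v f df -> is_derive x v F dF ->
  is_derive x v (fun z => f z *: F z) (df *: F x + f x *: dF).
Proof.
move=> Hf /is_derive_coord HF; apply/is_derive_coord => i; rewrite !mxE.
have -> : (fun z => (f z *: F z) 0 i) = f * (fun z => F z 0 i).
  by apply/funext => z; rewrite mxE.
by apply: is_derive_eq; rewrite -![_ *: _]/(_ * _) addrC (mulrC df).
Qed.

Lemma is_derive_mul {V : normedModType R} (f g : V -> R) (x v : V) df dg :
  is_derive x v f df -> is_derive x v g dg ->
  is_derive x v (fun z => f z * g z) (df * g x + f x * dg).
Proof.
move=> Hf Hg; refine (is_derive_eq (is_deriveM Hf Hg) _).
by rewrite -![_ *: _]/(_ * _) addrC (mulrC (g x)).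
Qed.

Lemma is_derive_opp {V W : normedModType R} (f : V -> W) (x v : V) df :
  is_derive x v f df -> is_derive x v (fun z => - f z) (- df).
Proof. by move=> Hf; refine (is_deriveN Hf). Qed.

Lemma is_derive_inv {V : normedModType R} (f : V -> R) (x v : V) df :
  is_derive x v f df -> f x != 0 -> is_derive x v (fun z => (f z)^-1) (- df / f x ^+ 2).
Proof.
move=> [dd <-] f0; split; first exact: derivableV.
by rewrite deriveV // -[_ *: _]/(_ * _) mulNr mulrC mulNr.
Qed.

Lemma smooth_on_dot_self (U : set 'rV[R]_n) : open U ->
  smooth_on U (fun z : 'rV[R]_n => dot z z).
Proof.
move=> oU; rewrite (_ : (fun z => _) = fun z : 'rV[R]_n => \sum_i z 0 i * z 0 i).
  by apply: smooth_on_sum => // i; apply: smooth_onM => //; exact: smooth_on_coordinate.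
by apply/funext => z; rewrite dotE.
Qed.

Lemma differentiable_dot_self y : differentiable (fun z : 'rV[R]_n => dot z z) y.
Proof. exact: (smooth_on_differentiable (smooth_on_dot_self openT)). Qed.

Lemma is_derive_enorm y v : y != 0 ->
  is_derive y v (@enorm R n) (dot v y / enorm y).
Proof.
move=> y0; have d0 : 0 < dot y y by rewrite dot_gt0.
have [dd E] := @is_derive_sqrt_comp _ _ (fun z : 'rV[R]_n => dot z z) y v d0 (differentiable_dot_self y).
split; first exact: diff_derivable.
have := is_derive_dot (is_derive_id y v) (is_derive_id y v) => -[_].
rewrite [X in X = _](_ : _ = 'D_v (fun z : 'rV[R]_n => dot z z) y) // => Ed.
rewrite [LHS]E Ed (dotC y v) -/(enorm y).
by have : enorm y != 0; [rewrite gt_eqF // enorm_gt0|move=> ?; field].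
Qed.

End euclid.

Section tangent.
Context {R : realType} {n : nat}.
Implicit Types u v w x y : 'rV[R]_(n + 1).

Lemma tprojZl c y u : c != 0 -> tproj (c *: y) u = tproj y u.
Proof.
move=> c0; rewrite /tproj !dotP scalerA; congr (_ - _ *: _).
have [->|y0] := eqVneq y 0; first by rewrite !(dotC _ 0) !dot0l !mulr0 !mul0r.
have : dot y y != 0 by rewrite dot_eq0.
by move=> ?; field; apply/andP.
Qed.

Lemma tprojD y u v : tproj y (u + v) = tproj y u + tproj y v.
Proof. by rewrite /tproj dotDl mulrDl scalerDl opprD addrACA. Qed.

Lemma tprojZ y a u : tproj y (a *: u) = a *: tproj y u.
Proof. by rewrite /tproj dotZl -mulrA scalerBr scalerA. Qed.

Lemma tproj0 y : tproj y 0 = 0 :> 'rV[R]_(n + 1).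
Proof. by rewrite /tproj dot0l mul0r scale0r subr0. Qed.

Lemma tproj_self y : tproj y y = 0.
Proof.
have [->|y0] := eqVneq y 0; first exact: tproj0.
by rewrite /tproj divff ?dot_eq0 // scale1r subrr.
Qed.

Lemma tproj_id y u : dot u y = 0 -> tproj y u = u.
Proof. by move=> uy; rewrite /tproj uy mul0r scale0r subr0. Qed.

Lemma tproj_tangent y u : y != 0 -> dot (tproj y u) y = 0.
Proof. by move=> y0; rewrite /tproj !dotP divfK ?dot_eq0 // subrr. Qed.

Lemma tproj_sum (I : Type) (s : seq I) y (F : I -> 'rV[R]_(n + 1)) :
  tproj y (\sum_(i <- s) F i) = \sum_(i <- s) tproj y (F i).
Proof. by apply: (big_morph (tproj y)); [exact: tprojD|exact: tproj0]. Qed.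

Lemma retr_neq0 (r : R) y : 0 < r -> y != 0 -> retr r y != 0.
Proof.
move=> r0 y0; rewrite /retr scaler_eq0 negb_or y0 andbT.
by rewrite gt_eqF // divr_gt0 // enorm_gt0.
Qed.

Lemma rsphere_neq0 (r : R) x : 0 < r -> rsphere r x -> x != 0.
Proof. by move=> r0 xr; rewrite -enorm_gt0 xr. Qed.

Lemma rsphere_dot (r : R) x : rsphere r x -> dot x x = r ^+ 2.
Proof. by move=> <-; rewrite enorm_sqr. Qed.

Lemma rsphereP (r : R) x : 0 < r -> rsphere r x <-> dot x x = r ^+ 2.
Proof.
move=> r0; split; first exact: rsphere_dot.
by rewrite /rsphere /= /enorm => ->; rewrite sqrtr_sqr gtr0_norm.
Qed.

Lemma retr_rsphere (r : R) y : 0 < r -> y != 0 -> rsphere r (retr r y).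
Proof.
move=> r0 y0; rewrite /rsphere /= /retr enormZ; last by rewrite divr_ge0 ?enorm_ge0 // ltW.
by rewrite divfK // gt_eqF // enorm_gt0.
Qed.

Lemma retr_id (r : R) x : 0 < r -> rsphere r x -> retr r x = x.
Proof. by move=> r0 xr; rewrite /retr xr divff ?scale1r // gt_eqF. Qed.

Lemma retrZ (r c : R) y : 0 < c -> retr r (c *: y) = retr r y.
Proof.
move=> c0; rewrite /retr enormZ ?ltW // scalerA; congr (_ *: _).
have [->|y0] := eqVneq y 0; first by rewrite /enorm dot0l sqrtr0 mulr0 invr0 !mulr0 mul0r.
have : enorm y != 0 by rewrite gt_eqF // enorm_gt0.
by move=> e0; field; rewrite e0 gt_eqF.
Qed.

Lemma tproj_retr (r : R) y u : 0 < r -> y != 0 -> tproj (retr r y) u = tproj y u.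
Proof.
by move=> r0 y0; rewrite /retr tprojZl // gt_eqF // divr_gt0 // enorm_gt0.
Qed.

Lemma open_neq0 k : open [set y : 'rV[R]_k | y != 0].
Proof.
rewrite (_ : [set _ | _] = (fun y : 'rV[R]_k => `|y|) @^-1` [set t : R | t != 0]).
  by apply: open_comp; [move=> y _; exact: norm_continuous|exact: open_neq].
by apply/seteqP; split => y /=; rewrite normr_eq0.
Qed.

Lemma near_neq0 k (z : 'rV[R]_k) : z != 0 -> \forall y \near z, y != 0.
Proof. by move=> z0; apply: open_nbhs_nbhs; split => //; exact: open_neq0. Qed.

Lemma is_derive_tproj y u v : y != 0 ->
  is_derive y v (fun z => tproj z u)
   (- ((dot u v / dot y y - 2 * dot u y * dot v y / dot y y ^+ 2) *: y
       + (dot u y / dot y y) *: v)).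
Proof.
move=> y0; have d0 : dot y y != 0 by rewrite dot_eq0.
have Hid := is_derive_id y v.
have H1 := is_derive_dot (is_derive_cst u y v) Hid.
have H2 := is_derive_inv (is_derive_dot Hid Hid) d0.
have H3 := is_deriveM H1 H2.
have H4 := is_derive_scale H3 Hid.
have H := is_deriveB (is_derive_cst u y v) H4.
refine (is_derive_eq H _); rewrite sub0r; congr (- (_ *: _ + _)).
rewrite -![_ *: _]/(_ * _) /= dot0l add0r (dotC y v).
by field.
Qed.

End tangent.

(** * Curvature of the unit sphere *)

Section curvature.
Context {R : realType} {n : nat}.
Implicit Types u v w x y p : 'rV[R]_(n + 1).

Lemma sdiff_tfield (r : R) u v x : 0 < r -> x != 0 ->
  sdiff r (tfield u) x v = 'D_v (fun y => tproj y u) x.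
Proof.
move=> r0 x0; apply: near_eq_derive; near=> y.
rewrite /tfield tproj_retr //; near: y; exact: near_neq0.
Unshelve. all: by end_near. Qed.

Lemma derive_tproj y u v : y != 0 ->
  'D_v (fun z => tproj z u) y =
   - ((dot u v / dot y y - 2 * dot u y * dot v y / dot y y ^+ 2) *: y
       + (dot u y / dot y y) *: v).
Proof. by move=> y0; have [_] := is_derive_tproj u v y0. Qed.

(** The derivative of the projection of w along a tangent vector a is, up to a normal
term, -<w,y> a. *)
Lemma nabla_tfield v w y : dot y y = 1 ->
  nabla 1 (tfield v) (tfield w) y = (- dot w y) *: tproj y v.
Proof.
move=> y1; have y0 : y != 0 by rewrite -dot_gt0 y1.
rewrite /nabla /cov sdiff_tfield // derive_tproj // y1 /tfield.
rewrite -scaleN1r tprojZ tprojD !tprojZ tproj_self scaler0 add0r divr1.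
rewrite (tproj_id (tproj_tangent v y0)) scalerA mulN1r //.
Qed.

(** At p the factor <w,y> of the covariant derivative of the field extending w
vanishes, so that differentiating it once more only hits this factor; the fields
extending u and v commute at p. *)
Lemma curvatureE p u v w : dot p p = 1 -> dot u p = 0 -> dot v p = 0 -> dot w p = 0 ->
  curvature 1 p u v w = dot v w *: u - dot u w *: v.
Proof.
move=> p1 up vp wp; have p0 : p != 0 by rewrite -dot_gt0 p1.
have second a b : dot a p = 0 -> dot b p = 0 ->
    nabla 1 (tfield a) (nabla 1 (tfield b) (tfield w)) p = - dot a w *: b.
  move=> ap bp; rewrite /nabla /cov -/(nabla 1 (tfield b) (tfield w)).
  rewrite [tfield a p](_ : _ = a); last by rewrite /tfield tproj_id.
  have -> : sdiff 1 (nabla 1 (tfield b) (tfield w)) p a =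
      'D_a (fun y => (- dot w y / enorm y) *: tproj y b) p.
    apply: near_eq_derive; near=> y.
    have y0 : y != 0 by near: y; exact: near_neq0.
    rewrite nabla_tfield; last by rewrite (rsphere_dot (retr_rsphere ltr01 y0)) expr1n.
    by rewrite tproj_retr // /retr dotZr mul1r mulrC mulNr mulrC.
  have H1 := is_derive_opp (is_derive_dot (is_derive_cst w p a) (is_derive_id p a)).
  have e1 : enorm p = 1 by rewrite /enorm p1 sqrtr1.
  have en0 : enorm p != 0 by rewrite e1 oner_eq0.
  have H2 := is_derive_inv (is_derive_enorm a p0) en0.
  have H3 := is_derive_mul H1 H2.
  have [_ ->] := is_derive_scale H3 (is_derive_tproj b a p0).
  rewrite /= /cst dot0l e1 p1 ap bp wp !(mul0r, oppr0, scale0r, addr0, add0r, mulr0) invr1 mulr1.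
  by rewrite tprojZ !tproj_id // (dotC w).
(* both derivatives are normal, equal to -<u,v> p *)
have bracket : lie_bracket 1 (tfield u) (tfield v) p = 0.
  rewrite /lie_bracket !sdiff_tfield // !derive_tproj // /tfield !tproj_id //.
  rewrite p1 up vp !(mul0r, mulr0, divr1, subr0, scale0r, addr0) (dotC v u).
  by rewrite subrr.
rewrite /curvature /curvature_field !second //.
rewrite {1}/nabla bracket /cov /sdiff derive0 tproj0 subr0.
by rewrite !scaleNr opprK addrC.
Unshelve. all: by end_near. Qed.

End curvature.

(** * Orthonormal frames and traces *)

Section frames.
Context {R : realType} {n : nat}.
Implicit Types x : 'rV[R]_(n + 1).

(** The Householder reflection exchanging x/|x| and the last basis vector: its first
n rows are the required frame. When x/|x| is that basis vector, the convention
2/0 = 0 turns the reflection into the identity, which is what is wanted. *)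
Lemma orthonormal_frame_exists x : x != 0 -> orthonormal_frame x !=set0.
Proof.
move=> x0.
have N0 : enorm x != 0 by rewrite gt_eqF // enorm_gt0.
pose xh := (enorm x)^-1 *: x.
have xh1 : dot xh xh = 1.
  by rewrite /xh !dotP -enorm_sqr; field.
have xE : x = enorm x *: xh by rewrite /xh scalerA divff // scale1r.
clearbody xh.
pose E : 'rV[R]_(n + 1) := delta_mx 0 (rshift n ord0).
have E1 : dot E E = 1.
  rewrite dotE (bigD1 (rshift n ord0)) //= !mxE !eqxx mulr1 big1 ?addr0 // => i iN.
  by rewrite !mxE (negbTE iN) mulr0.
have Ei i : E 0 (lshift 1 i) = 0 by rewrite mxE eqxx eq_lrshift.
clearbody E.
pose v := xh - E.
pose s := dot v v.
(* 1 - c v^T v is the reflection along v; c = 0 if v = 0. *)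
pose c := 2 / s.
pose H : 'M[R]_(n + 1) := 1%:M - c *: (v^T *m v).
have HT : H^T = H by rewrite /H linearB /= linearZ /= trmx1 trmx_mul trmxK.
have cs : c * c * s = 2 * c.
  rewrite /c; have [->|s0] := eqVneq s 0; first by rewrite invr0 !mulr0.
  by field.
have vv : v *m v^T = s%:M by rewrite [LHS]mx11_scalar.
have HH : H *m H^T = 1%:M.
  have XX : (v^T *m v) *m (v^T *m v) = s *: (v^T *m v).
    by rewrite -mulmxA (mulmxA v) vv mul_scalar_mx scalemxAr.
  rewrite HT /H; set X := v^T *m v in XX *.
  rewrite mulmxBl !mulmxBr !mul1mx mulmx1 -scalemxAl -scalemxAr XX !scalerA cs.
  by clearbody X; apply/matrixP => i j; rewrite !mxE; ring.
have xH : xh *m H = E.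
  rewrite /H mulmxBr mulmx1 -scalemxAr mulmxA.
  have -> : xh *m v^T = (dot xh v)%:M by rewrite [LHS]mx11_scalar.
  rewrite mul_scalar_mx scalerA.
  have sE : s = 2 * dot xh v.
    by rewrite /s /v !dotP xh1 E1 (dotC E xh); ring.
  have [s0|s0] := eqVneq s 0.
    have v0 : v = 0 by apply/eqP; rewrite -dot_eq0 -/s s0.
    by rewrite v0 scaler0 subr0; apply/eqP; rewrite -subr_eq0 -/v v0.
  have -> : c * dot xh v = 1 by rewrite /c; move: s0; rewrite sE => s0; field; move: s0; rewrite mulf_eq0 negb_or => /andP[].
  by rewrite scale1r /v opprB addrC subrK.
clearbody H.
exists (usubmx H); split.
  apply/matrixP => i j; have := congr1 (fun M : 'M[R]_(n + 1) => M (lshift 1 i) (lshift 1 j)) HH.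
  rewrite !mxE (inj_eq (@lshift_inj _ _)) => <-.
  by apply: eq_bigr => k _; rewrite !mxE.
move=> i; rewrite /rtangent /= dotC.
rewrite xE dotZl.
have -> : dot xh (row i (usubmx H)) = (xh *m H^T) 0 (lshift 1 i).
  by rewrite dotE mxE; apply: eq_bigr => k _; rewrite !mxE.
by rewrite HT xH Ei mulr0.
Qed.

Lemma frameP x : x != 0 -> orthonormal_frame x (frame x).
Proof. by move=> x0; apply: getPex; have [e] := orthonormal_frame_exists x0; exists e. Qed.

Lemma frame_vec_tangent x i : x != 0 -> dot (frame_vec x i) x = 0.
Proof. by move=> /frameP[_]; exact. Qed.

(** Completing the frame by x/|x| gives an orthogonal matrix, whose transpose is
orthogonal as well. *)
Lemma frame_gram x : x != 0 ->
  (frame x)^T *m frame x = 1%:M - (dot x x)^-1 *: (x^T *m x).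
Proof.
move=> x0; have [ee ex] := frameP x0.
have d0 : dot x x != 0 by rewrite dot_eq0.
have N0 : enorm x != 0 by rewrite gt_eqF // enorm_gt0.
pose xh := (enorm x)^-1 *: x.
have exT : frame x *m x^T = 0.
  apply/matrixP => i j; rewrite !mxE.
  transitivity (dot (row i (frame x)) x); last exact: ex.
  by rewrite dotE; apply: eq_bigr => k _; rewrite !mxE (ord1 j).
pose M : 'M[R]_(n + 1) := col_mx (frame x) xh.
have MM : M *m M^T = 1%:M.
  rewrite /M tr_col_mx mul_col_row ee /xh linearZ /= -scalemxAr exT scaler0.
  rewrite -scalemxAl -[x *m _]trmxK trmx_mul trmxK exT trmx0 scaler0.
  rewrite -scalemxAl -scalemxAr scalerA [x *m _]mx11_scalar -/(dot x x) -invfM -expr2 enorm_sqr.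
  by rewrite scale_scalar_mx mulVf // -scalar_mx_block.
have := mulmx1C MM.
rewrite /M tr_col_mx mul_row_col => /(canRL (addrK _)) ->; congr (_ - _).
by rewrite /xh [(_ *: x)^T]linearZ /= -scalemxAl -scalemxAr scalerA -invfM -expr2 enorm_sqr.
Qed.

Lemma frame_gramE x k l : x != 0 ->
  \sum_i frame_vec x i 0 k * frame_vec x i 0 l = (k == l)%:R - x 0 k * x 0 l / dot x x.
Proof.
move=> x0; have := congr1 (fun M : 'M[R]_(n + 1) => M k l) (frame_gram x0).
rewrite !mxE big_ord1 !mxE => E; rewrite mulrC -E; apply: eq_bigr => i _; by rewrite !mxE.
Qed.

(** This replaces frames by the standard basis, at the cost of the value of the form
on the normal; that value vanishes in all the applications. *)
Lemma frame_trace x (B : 'I_(n + 1) -> 'I_(n + 1) -> R) : x != 0 ->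
  \sum_i \sum_k \sum_l frame_vec x i 0 k * frame_vec x i 0 l * B k l =
  \sum_k B k k - (\sum_k \sum_l x 0 k * x 0 l * B k l) / dot x x.
Proof.
move=> x0; rewrite exchange_big /=.
under eq_bigr => k _.
  rewrite exchange_big /=.
  under eq_bigr => l _ do rewrite -mulr_suml frame_gramE // mulrBl.
  rewrite sumrB (bigD1 k) //= eqxx mul1r big1 ?addr0; last first.
    by move=> l /negbTE; rewrite eq_sym => ->; rewrite mul0r.
  over.
rewrite sumrB mulr_suml; congr (_ - _); apply: eq_bigr => k _.
by rewrite mulr_suml; apply: eq_bigr => l _; rewrite mulrAC.
Qed.

Lemma frame_sum_sqr x (c : 'I_(n + 1) -> R) : x != 0 -> \sum_k x 0 k * c k = 0 ->
  \sum_i (\sum_k frame_vec x i 0 k * c k) ^+ 2 = \sum_k c k ^+ 2.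
Proof.
move=> x0 xc.
have sqrE (y : 'rV[R]_(n + 1)) :
    \sum_k \sum_l y 0 k * y 0 l * (c k * c l) = (\sum_k y 0 k * c k) ^+ 2.
  rewrite expr2 mulr_suml; apply: eq_bigr => k _; rewrite mulr_sumr.
  by apply: eq_bigr => l _; ring.
under eq_bigr do rewrite -sqrE.
rewrite frame_trace // sqrE xc expr0n mul0r subr0.
by apply: eq_bigr => k _; rewrite expr2.
Qed.
End frames.

(** * A frame-free formula for the density *)

Section derivative_sums.
Context {R : realType} {V : normedModType R}.

Lemma is_derive_sumE n (f : 'I_n -> V -> R) (x v : V) (df : 'I_n -> R) :
  (forall i, is_derive x v (f i) (df i)) ->
  is_derive x v (fun y => \sum_(i < n) f i y) (\sum_(i < n) df i).
Proof.
move=> H; have := is_derive_sum H; congr (is_derive _ _ _ _).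
by apply/funext => y; rewrite fct_sumE.
Qed.

End derivative_sums.

Section homogeneous.
Context {R : realType} {m : nat} {W : normedModType R}.
Implicit Types (F : 'rV[R]_m -> W).

Lemma derive_basis F x v : differentiable F x ->
  'D_v F x = \sum_k v 0 k *: 'D_('e_k) F x.
Proof.
move=> dF; rewrite deriveE // {1}(row_sum_delta v) linear_sum.
by apply: eq_bigr => k _; rewrite linearZ /= deriveE.
Qed.

Lemma derive_homog0 F y : (forall c z, 0 < c -> F (c *: z) = F z) -> 'D_y F y = 0.
Proof.
move=> hF; apply/lim_near_cst => //=; near=> h.
have -> : h *: y + y = (h + 1) *: y by rewrite scalerDl scale1r.
rewrite hF ?subrr ?scaler0 //.
rewrite -ltrBlDr sub0r.
have : `|h| < 1 by near: h; exact: dnbhs0_lt.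
by rewrite ltr_norml => /andP[].
Unshelve. all: by end_near. Qed.

(** Differentials of functions constant along rays are homogeneous of degree -1. *)
Lemma derive_homogZ F y v c : (forall c z, 0 < c -> F (c *: z) = F z) -> 0 < c ->
  differentiable F (c *: y) -> 'D_v F (c *: y) = c^-1 *: 'D_v F y.
Proof.
move=> hF c0 dF.
have -> : 'D_v F y = 'D_(c *: v) F (c *: y).
  rewrite /derive /=.
  suff -> : (fun h : R => h^-1 *: (F (h *: v + y) - F y)) =
    (fun h : R => h^-1 *: (F (h *: (c *: v) + c *: y) - F (c *: y))) by [].
  apply/funext => h; rewrite -(hF c (h *: v + y)) // -(hF c y) //.
  by congr (_ *: (F _ - _)); rewrite scalerDr !scalerA mulrC.
by rewrite !deriveE // linearZ /= scalerA mulVf ?scale1r // gt_eqF.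
Qed.

End homogeneous.

Section second_derivatives.
Context {R : realType} {m : nat}.
Implicit Types (w : 'rV[R]_m -> R) (U : set 'rV[R]_m).

Definition laplacian w (x : 'rV[R]_m) : R := \sum_k 'D_('e_k) ('D_('e_k) w) x.

Lemma derive2_basis w U x u v : open U -> U x -> smooth_on U w ->
  'D_u ('D_v w) x = \sum_k \sum_l u 0 k * v 0 l * 'D_('e_k) ('D_('e_l) w) x.
Proof.
move=> oU Ux sw.
have sD z := smooth_on_derive z sw.
rewrite (derive_basis _ (smooth_on_differentiable (sD v) Ux)).
apply: eq_bigr => k _; rewrite -[_ *: _]/(_ * _).
have -> : 'D_('e_k) ('D_v w) x = 'D_('e_k) (fun y => \sum_l v 0 l * 'D_('e_l) w y) x.
  apply: near_eq_derive; apply: filterS (open_nbhs_nbhs (conj oU Ux)) => y Uy.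
  by rewrite (derive_basis _ (smooth_on_differentiable sw Uy)).
have H l : is_derive x 'e_k (fun y => v 0 l * 'D_('e_l) w y) (v 0 l * 'D_('e_k) ('D_('e_l) w) x).
  have H1 := derivableP (@smooth_on_derivable _ _ _ _ _ _ 'e_k (sD 'e_l) Ux).
  by have := is_derive_mul (is_derive_cst (v 0 l) x 'e_k) H1; rewrite mul0r add0r.
have [_ ->] := is_derive_sumE H.
by rewrite mulr_sumr; apply: eq_bigr => l _; rewrite mulrA.
Qed.

End second_derivatives.

Section wedge.
Context {R : comRingType} {N : nat}.
Implicit Types p q a d : 'I_N -> R.

Lemma sum_wedge1 p a d b e :
  \sum_k p k * (b * d k - a k * e) = b * (\sum_k p k * d k) - e * (\sum_k p k * a k).
Proof.
by rewrite !mulr_sumr -sumrB; apply: eq_bigr => k _; ring.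
Qed.

(** The curvature of the unit sphere applied to d phi(p), d phi(q) and tau, written
in coordinates. *)
Lemma sum_wedge2 p q a d :
  \sum_k p k * (\sum_l q l * (a l * d k - a k * d l)) =
  (\sum_l q l * a l) * (\sum_k p k * d k) - (\sum_k p k * a k) * (\sum_l q l * d l).
Proof.
rewrite (eq_bigr (fun k => p k * ((\sum_l q l * a l) * d k - a k * \sum_l q l * d l))).
  by rewrite sum_wedge1 (mulrC (\sum_k p k * a k)).
move=> k _; congr (_ * _); rewrite mulr_suml mulr_sumr -sumrB.
by apply: eq_bigr => l _; ring.
Qed.
End wedge.

Section density.
Context {R : realType} {m n : nat} (r : R) (phi : 'rV[R]_(m + 1) -> 'rV[R]_(n + 1)).
Hypothesis r0 : 0 < r.
Hypothesis sphi : smooth_map r 1 phi.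

Let U : set 'rV[R]_(m + 1) := [set y | y != 0].
Let W (y : 'rV[R]_(m + 1)) : 'rV[R]_(n + 1) := phi (retr r y).
Let w c (y : 'rV[R]_(m + 1)) : R := phi (retr r y) 0 c.
Let oU : open U := @open_neq0 R (m + 1).
Let sW : smooth_on U W. Proof. by have [] := sphi. Qed.
Let sw c : smooth_on U (w c). Proof. exact: smooth_on_coord. Qed.

Let hW c z : 0 < c -> W (c *: z) = W z.
Proof. by move=> c0; rewrite /W retrZ. Qed.

Let W1 y : y != 0 -> dot (W y) (W y) = 1.
Proof.
move=> y0; have [_ H] := sphi.
by rewrite (rsphere_dot (H _ (retr_rsphere r0 y0))) expr1n.
Qed.

Let DW y v c : y != 0 -> 'D_v W y 0 c = 'D_v (w c) y.
Proof. by move=> y0; rewrite derive_mx ?mxE //; exact: smooth_on_derivable sW y0. Qed.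

Let DDW y u v c : y != 0 -> 'D_u ('D_v W) y 0 c = 'D_u ('D_v (w c)) y.
Proof.
move=> y0; rewrite derive_mx ?mxE; last first.
  by apply: smooth_on_derivable y0; exact: smooth_on_derive.
apply: near_eq_derive; apply: filterS (near_neq0 y0) => z z0; exact: DW.
Qed.

Let DW_tangent y v : y != 0 -> dot ('D_v W y) (W y) = 0.
Proof.
move=> y0; have dW := derivableP (@smooth_on_derivable _ _ _ _ _ _ v sW y0).
have [_ H] := is_derive_dot dW dW.
have E : 'D_v (fun z => dot (W z) (W z)) y = 'D_v (cst (1 : R)) y.
  by apply: near_eq_derive; apply: filterS (near_neq0 y0) => z; exact: W1.
move: E; rewrite H derive_cst (dotC (W y)) -mulr2n => /eqP.
by rewrite mulrn_eq0 /= => /eqP.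
Qed.

Let sdiffE (y v : 'rV[R]_(m + 1)) : y != 0 ->
  sdiff r phi (retr r y) v = (enorm y / r) *: 'D_v W y.
Proof.
move=> y0; rewrite /sdiff -/W /retr derive_homogZ //.
- by rewrite invf_div.
- by rewrite divr_gt0 // enorm_gt0.
- by apply: (smooth_on_differentiable sW); exact: retr_neq0.
Qed.

(** The Christoffel term drops out, because the covariant derivative at x of the field
extending v is zero. The radial part of the projected direction contributes
nothing, since W is constant along rays, and the factor |y|/r coming from
homogeneity has zero derivative in tangent directions. *)
Lemma second_fundamental_formE x u v : rsphere r x -> dot u x = 0 -> dot v x = 0 ->
  second_fundamental_form r phi x u v = tproj (phi x) ('D_u ('D_v W) x).
Proof.
move=> xr ux vx; have x0 := rsphere_neq0 r0 xr.
have nab : nabla r (tfield u) (tfield v) x = 0.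
  have Tu : tfield u x = u by rewrite /tfield tproj_id.
  rewrite /nabla /cov Tu sdiff_tfield // derive_tproj //.
  rewrite vx ux !(mul0r, mulr0, subr0, scale0r, addr0).
  by rewrite -scaleNr tprojZ tproj_self scaler0.
have z0 : sdiff r phi x 0 = 0 by rewrite /sdiff derive0.
rewrite /second_fundamental_form nab z0 subr0 /cov.
suff -> : sdiff r (fun y => sdiff r phi y (tfield v y)) x u = 'D_u ('D_v W) x by [].
transitivity ('D_u (fun y => sdiff r phi (retr r y) (tfield v (retr r y))) x); first by [].
have -> : 'D_u (fun y => sdiff r phi (retr r y) (tfield v (retr r y))) x =
   'D_u (fun y => (enorm y / r) *: 'D_v W y) x.
  apply: near_eq_derive; apply: filterS (near_neq0 x0) => y y0.
  rewrite (sdiffE _ y0) /tfield (tproj_retr v r0 y0).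
  suff -> : 'D_(tproj y v) W y = 'D_v W y by [].
  have dW := smooth_on_differentiable sW y0.
  have Dy : 'd W y y = 0 by rewrite -deriveE // (derive_homog0 _ hW).
  by rewrite !deriveE // /tproj linearB linearZ /= Dy scaler0 subr0.
have H1 := is_derive_mul (is_derive_enorm u x0) (is_derive_cst r^-1 x u).
have H2 := derivableP (@smooth_on_derivable _ _ _ _ _ _ u (smooth_on_derive v sW) x0).
have [_ ->] := is_derive_scale H1 H2.
by rewrite ux /cst !(mul0r, mulr0) addr0 scale0r add0r xr divff ?scale1r // gt_eqF.
Qed.

Let lapW x : 'rV[R]_(n + 1) := \row_c laplacian (w c) x.

(** The flat Laplacian differs from the trace over the tangent space by the second
derivative along x, which vanishes on functions constant along rays. *)
Lemma tensionE x : rsphere r x -> tension r phi x = tproj (phi x) (lapW x).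
Proof.
move=> xr; have x0 := rsphere_neq0 r0 xr.
rewrite /tension (eq_bigr (fun i => tproj (phi x) ('D_(frame_vec x i) ('D_(frame_vec x i) W) x))).
  rewrite -tproj_sum; congr tproj; apply/rowP => c; rewrite summxE mxE.
  under eq_bigr => i _ do rewrite DDW // (derive2_basis _ _ oU x0 (sw c)).
  rewrite frame_trace //.
  rewrite -(derive2_basis _ _ oU x0 (sw c)).
  suff -> : 'D_x ('D_x (w c)) x = 0 by rewrite mul0r subr0.
  have hw a z : 0 < a -> w c (a *: z) = w c z by move=> a0; rewrite /w retrZ.
  apply/lim_near_cst => //=; near=> h.
  have h1 : 0 < h + 1.
    rewrite -ltrBlDr sub0r.
    have : `|h| < 1 by near: h; exact: dnbhs0_lt.
    by rewrite ltr_norml => /andP[].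
  have hx : h *: x + x = (h + 1) *: x by rewrite scalerDl scale1r.
  rewrite hx derive_homogZ //.
    by rewrite derive_homog0 // scaler0 subr0 scaler0.
  apply: (smooth_on_differentiable (sw c)); rewrite /U /= scaler_eq0 negb_or x0 andbT.
  by rewrite gt_eqF.
by move=> i _; rewrite second_fundamental_formE // frame_vec_tangent.
Unshelve. all: by end_near. Qed.

(** The components of the one-form <d phi, tau(phi)>, up to sign the divergence of the
stress-energy tensor of phi. The Laplacian need not be projected, as d phi is
tangent to the target sphere. *)
Definition stress (x : 'rV[R]_(m + 1)) (k : 'I_(m + 1)) : R :=
  \sum_c 'D_('e_k) (fun y => phi (retr r y) 0 c) x * laplacian (fun y => phi (retr r y) 0 c) x.

Let dW_tension x u : rsphere r x ->
  dot ('D_u W x) (tension r phi x) = \sum_k u 0 k * stress x k.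
Proof.
move=> xr; have x0 := rsphere_neq0 r0 xr.
have Wx : phi x = W x by rewrite /W retr_id.
rewrite tensionE // /tproj Wx !dotP DW_tangent // mulr0 subr0 dotE.
have E c : 'D_u W x 0 c = \sum_k u 0 k * 'D_('e_k) (w c) x.
  by rewrite DW // (derive_basis _ (smooth_on_differentiable (sw c) x0)).
under eq_bigr => c _ do rewrite E mulr_suml.
rewrite exchange_big; apply: eq_bigr => k _ /=.
by rewrite /stress mulr_sumr; apply: eq_bigr => c _; rewrite mxE mulrA.
Qed.

(** For each coordinate c the integrand is a sum over the frame of the squares of a
bilinear form in two frame vectors, and this form vanishes when one of the
arguments is x: the derivative of W along x is zero, hence so is the stress. *)
Lemma E4_densityE x : rsphere r x ->
  E4_density r 1 phi x = \sum_k \sum_l \sum_c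
    (stress x l * 'D_('e_k) (fun y => phi (retr r y) 0 c) x
     - stress x k * 'D_('e_l) (fun y => phi (retr r y) 0 c) x) ^+ 2.
Proof.
move=> xr; have x0 := rsphere_neq0 r0 xr.
have Wx : phi x = W x by rewrite /W retr_id.
pose B k l c := stress x l * 'D_('e_k) (w c) x - stress x k * 'D_('e_l) (w c) x.
have Dw u c : 'D_u W x 0 c = \sum_k u 0 k * 'D_('e_k) (w c) x.
  by rewrite DW // (derive_basis _ (smooth_on_differentiable (sw c) x0)).
have Dxw c : \sum_k x 0 k * 'D_('e_k) (w c) x = 0.
  by rewrite -Dw derive_homog0 // mxE.
have Dxa : \sum_k x 0 k * stress x k = 0.
  by rewrite -dW_tension // derive_homog0 // dot0l.
have xB l c : \sum_k x 0 k * B k l c = 0.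
  by rewrite /B sum_wedge1 Dxw Dxa !mulr0 subrr.
have BN k l c : B l k c = - B k l c by rewrite /B opprB.
have term i j : enorm (curvature 1 (phi x) (sdiff r phi x (frame_vec x i))
             (sdiff r phi x (frame_vec x j)) (tension r phi x)) ^+ 2 =
    \sum_c (\sum_k frame_vec x i 0 k * (\sum_l frame_vec x j 0 l * B k l c)) ^+ 2.
  rewrite enorm_sqr /sdiff -/W curvatureE; first last.
  - rewrite tensionE // tproj_tangent // -dot_gt0 Wx W1 //.
  - by rewrite Wx DW_tangent.
  - by rewrite Wx DW_tangent.
  - by rewrite Wx W1.
  rewrite dotE; apply: eq_bigr => c _; rewrite -expr2; congr (_ ^+ 2).
  by rewrite sum_wedge2 -!Dw -!dW_tension // !mxE.
rewrite /E4_density.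
under eq_bigr => i _ do under eq_bigr => j _ do rewrite term.
rewrite exchange_big /=.
transitivity (\sum_j \sum_c \sum_k (\sum_l frame_vec x j 0 l * B k l c) ^+ 2).
  apply: eq_bigr => j _; rewrite exchange_big /=; apply: eq_bigr => c _.
  apply: frame_sum_sqr => //.
  under eq_bigr => k _ do rewrite mulr_sumr.
  rewrite exchange_big big1 // => l _ /=.
  by under eq_bigr => k _ do rewrite mulrCA; rewrite -mulr_sumr xB mulr0.
transitivity (\sum_k \sum_c \sum_l B k l c ^+ 2).
  rewrite (eq_bigr (fun j => \sum_k \sum_c (\sum_l frame_vec x j 0 l * B k l c) ^+ 2)); last first.
    by move=> j _; rewrite exchange_big.
  rewrite exchange_big; apply: eq_bigr => k _; rewrite exchange_big; apply: eq_bigr => c _ /=.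
  apply: frame_sum_sqr => //.
  by under eq_bigr => l _ do rewrite BN mulrN; rewrite sumrN xB oppr0.
by apply: eq_bigr => k _; rewrite exchange_big.
Qed.

End density.

(** * The stereographic chart *)

Section stereographic.
Context {R : realType} {m : nat}.
Implicit Types u v w : 'rV[R]_m.

Lemma dot_row_mx k1 k2 (a c : 'rV[R]_k1) (b d : 'rV[R]_k2) :
  dot (row_mx a b) (row_mx c d) = dot a c + dot b d.
Proof. by rewrite /dot tr_row_mx mul_row_col mxE. Qed.

Lemma dot_scalar_mx (a b : R) : dot (a%:M : 'rV[R]_1) b%:M = a * b.
Proof. by rewrite dotE big_ord1 !mxE eqxx !mulr1n. Qed.

Lemma is_derive_row_mx (V : normedModType R) k1 k2 (F : V -> 'rV[R]_k1) (G : V -> 'rV[R]_k2)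
    (x v : V) dF dG :
  is_derive x v F dF -> is_derive x v G dG ->
  is_derive x v (fun z => row_mx (F z) (G z)) (row_mx dF dG).
Proof.
move=> /is_derive_coord HF /is_derive_coord HG; apply/is_derive_coord => i.
rewrite mxE; under eq_fun do rewrite mxE.
by case: (fintype.split i) => j.
Qed.

Lemma is_derive_scalar_mx (V : normedModType R) (f : V -> R) (x v : V) df :
  is_derive x v f df -> is_derive x v (fun z => (f z)%:M : 'rV[R]_1) (df%:M).
Proof.
move=> H; apply/is_derive_coord => i; rewrite (ord1 i) mxE mulr1n.
by under eq_fun do rewrite mxE mulr1n.
Qed.

Lemma one_plus_dot_gt0 u : 0 < 1 + dot u u.
Proof. by rewrite ltr_pwDl // dot_ge0. Qed.

Lemma stereo_rsphere (r : R) u : 0 < r -> rsphere r (stereo r u).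
Proof.
move=> r0; apply/rsphereP => //.
rewrite /stereo !dotP dot_row_mx !dotP dot_scalar_mx.
by field; rewrite gt_eqF // one_plus_dot_gt0.
Qed.

Lemma smooth_stereo (r : R) : smooth_on setT (@stereo R m r).
Proof.
have oT := @openT 'rV[R]_m.
apply: smooth_on_row => // i.
have s1 : smooth_on setT (fun u : 'rV[R]_m => r / (1 + dot u u)).
  apply: smooth_onM => //; first exact: smooth_on_cst.
  apply: smooth_onV => // [u _|]; first by rewrite gt_eqF // one_plus_dot_gt0.
  by apply: smooth_onD => //; [exact: smooth_on_cst|exact: smooth_on_dot_self].
rewrite /stereo; under eq_fun do rewrite mxE.
apply: smooth_onM => //; under eq_fun do rewrite mxE.
case: (fintype.split i) => j; under eq_fun do rewrite mxE.
  by apply: smooth_onM => //; [exact: smooth_on_cst|exact: smooth_on_coordinate].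
rewrite (ord1 j) /=; under eq_fun do rewrite mulr1n.
by apply: smooth_onB => //; [exact: smooth_on_dot_self|exact: smooth_on_cst].
Qed.

Lemma derive_stereo (r : R) u v : 'D_v (@stereo R m r) u =
  (- (2 * r * dot u v) / (1 + dot u u) ^+ 2) *:
     row_mx (2 *: u) ((dot u u - 1)%:M : 'rV[R]_1)
  + (r / (1 + dot u u)) *: row_mx (2 *: v) ((2 * dot u v)%:M : 'rV[R]_1).
Proof.
have s0 : 1 + dot u u != 0 by rewrite gt_eqF // one_plus_dot_gt0.
have Hid := is_derive_id u v.
have Hd := is_derive_dot Hid Hid.
have H1 := is_derive_mul (is_derive_cst r u v)
   (is_derive_inv (is_deriveD (is_derive_cst (1 : R) u v) Hd) s0).
have H2 := is_derive_row_mx (is_derive_scale (is_derive_cst (2 : R) u v) Hid)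
   (is_derive_scalar_mx (is_deriveB Hd (is_derive_cst (1 : R) u v))).
have [_ E] := is_derive_scale H1 H2.
rewrite [LHS]E (dotC v u) scale0r add0r subr0 mul0r !add0r; congr (_ *: _ + _ *: row_mx _ _%:M).
  by rewrite /cst [X in _ / X](_ : _ = (1 + dot u u) ^+ 2) //; field.
by ring.
Qed.

(** The inverse stereographic projection is conformal, with factor 2r/(1+|u|^2). *)
Lemma dot_derive_stereo (r : R) u v w :
  dot ('D_v (@stereo R m r) u) ('D_w (@stereo R m r) u) =
  (2 * r / (1 + dot u u)) ^+ 2 * dot v w.
Proof.
rewrite !derive_stereo !dotP !dot_row_mx !dotP !dot_scalar_mx (dotC v u).
by field; rewrite gt_eqF // one_plus_dot_gt0.
Qed.

Lemma stereo_volume (r : R) u : 0 < r ->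
  Num.sqrt (\det ('J (@stereo R m r) u *m ('J (@stereo R m r) u)^T)) =
  (2 * r / (1 + dot u u)) ^+ m.
Proof.
move=> r0; set c := 2 * r / (1 + dot u u).
have c0 : 0 <= c by rewrite divr_ge0 ?mulr_ge0 // ltW // one_plus_dot_gt0.
have dst : differentiable (@stereo R m r) u.
  exact: (smooth_on_differentiable (@smooth_stereo r)).
have -> : 'J (@stereo R m r) u *m ('J (@stereo R m r) u)^T = (c ^+ 2)%:M.
  apply/matrixP => i j.
  transitivity (dot ('D_('e_i) (@stereo R m r) u) ('D_('e_j) (@stereo R m r) u)).
    rewrite !deriveEjacobian // -!rowE dotE mxE.
    by apply: eq_bigr => k _; rewrite !mxE.
  rewrite dot_derive_stereo [RHS]mxE -[RHS]mulr_natr; congr (_ * _).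
  rewrite dotE (bigD1 i) //= big1 ?addr0 => [|k ki]; rewrite !mxE !eqxx /=.
    by rewrite mul1r.
  by rewrite (negbTE ki) mul0r.
by rewrite det_scalar -exprM mulnC exprM sqrtr_sqr ger0_norm // exprn_ge0.
Qed.

Lemma stereo_volume_bound (r : R) u : 0 < r ->
  `|(2 * r / (1 + dot u u)) ^+ m| <= (2 * r) ^+ m * cauchy_weight u.
Proof.
move=> r0; have s0 := one_plus_dot_gt0 u.
rewrite ger0_norm; last by rewrite exprn_ge0 // divr_ge0 ?mulr_ge0 // ltW.
rewrite expr_div_n; apply: ler_wpM2l; first by rewrite exprn_ge0 // mulr_ge0 // ltW.
have -> : ((1 + dot u u) ^+ m)^-1 = \prod_(i < m) (1 + dot u u)^-1.
  by rewrite prodr_const card_ord exprVn.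
rewrite /cauchy_weight; apply: ler_prod => i _; rewrite invr_ge0 (ltW s0) /=.
rewrite lef_pV2 ?posrE ?ltr_pwDl ?sqr_ge0 //.
  rewrite lerD2l dotE (bigD1 i) //= -expr2 lerDl.
  by apply: sumr_ge0 => j _; rewrite -expr2 sqr_ge0.
by rewrite dot_ge0.
Qed.

Lemma sphere_integralE (r : R) (F : 'rV[R]_(m + 1) -> R) : 0 < r ->
  sphere_integral r F = Rn_integral (fun u : 'rV[R]_m =>
    (2 * r / (1 + dot u u)) ^+ m * F (stereo r u)).
Proof.
by move=> r0; congr Rn_integral; apply/funext => u; rewrite stereo_volume // mulrC.
Qed.

Lemma sphere_integral_ext (r : R) (F G : 'rV[R]_(m + 1) -> R) : 0 < r ->
  (forall x, rsphere r x -> F x = G x) -> sphere_integral r F = sphere_integral r G.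
Proof.
move=> r0 FG; rewrite !sphere_integralE //; congr Rn_integral; apply/funext => u.
by rewrite FG //; exact: stereo_rsphere.
Qed.

Lemma sphere_integral_ge0 (r : R) (F : 'rV[R]_(m + 1) -> R) :
  (forall x, 0 <= F x) -> 0 <= sphere_integral r F.
Proof. by move=> F0; apply: Rn_integral_ge0 => u; rewrite mulr_ge0 // sqrtr_ge0. Qed.

Lemma cauchy_bounded_stereo (r C : R) (F : 'rV[R]_(m + 1) -> R) : 0 < r ->
  (forall x, rsphere r x -> {for x, continuous F}) ->
  (forall x, rsphere r x -> `|F x| <= C) ->
  cauchy_bounded (C * (2 * r) ^+ m)
    (fun u : 'rV[R]_m => (2 * r / (1 + dot u u)) ^+ m * F (stereo r u)).
Proof.
move=> r0 cF bF; have oT := @openT 'rV[R]_m; split=> [u|u].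
  apply: (@continuousM _ _ (fun u : 'rV[R]_m => (2 * r / (1 + dot u u)) ^+ m)
     (fun u => F (stereo r u)) u).
    have : smooth_on setT (fun u : 'rV[R]_m => 2 * r / (1 + dot u u)).
      apply: smooth_onM => //; first exact: smooth_on_cst.
      apply: smooth_onV => // [z _|]; first by rewrite gt_eqF // one_plus_dot_gt0.
      by apply: smooth_onD => //; [exact: smooth_on_cst|exact: smooth_on_dot_self].
    by move=> /(smooth_onX m oT) /(_ 0%N u I).
  apply: (@continuous_comp _ _ _ (@stereo R m r) F).
    exact: (@smooth_stereo r 0%N).
  by apply: cF; exact: stereo_rsphere.
rewrite normrM [leLHS]mulrC -[leRHS]mulrA; apply: ler_pM => //.
  by apply: bF; exact: stereo_rsphere.
exact: stereo_volume_bound.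
Qed.

End stereographic.

(** * Differentiation of integrals over the sphere *)

Section spacetime.
Context {R : realType} {m : nat}.
Implicit Types (F : R * 'rV[R]_(m + 1) -> R) (x y : 'rV[R]_(m + 1)).

(** The domain of (t, y) |-> Phi t (retr y) for a variation Phi: the sphere is thickened
to the punctured space, so that derivatives in all directions make sense. *)
Definition spacetime (eps : R) : set (R * 'rV[R]_(m + 1)) :=
  [set p | `|p.1| < eps /\ p.2 != 0].

Definition Dt F (p : R * 'rV[R]_(m + 1)) : R := 'D_((1 : R), (0 : 'rV[R]_(m + 1))) F p.
Definition Dx (k : 'I_(m + 1)) F (p : R * 'rV[R]_(m + 1)) : R :=
  'D_((0 : R), ('e_k : 'rV[R]_(m + 1))) F p.

Lemma open_spacetime eps : open (spacetime eps).
Proof.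
rewrite (_ : spacetime eps = (fun p => `|p.1|) @^-1` [set t | t < eps] `&`
   (fun p => p.2) @^-1` [set y | y != 0]); last by apply/seteqP; split => p.
apply: openI; apply: open_comp.
- move=> p _; apply: (@continuous_comp _ _ _ fst (fun t : R => `|t|)).
    exact: cvg_fst.
  exact: norm_continuous.
- exact: open_lt.
- by move=> p _; exact: cvg_snd.
- exact: open_neq0.
Qed.

Lemma derive_time F t x : 'D_1 (fun s : R => F (s, x)) t = Dt F (t, x).
Proof.
apply: (@derive_comp_affine _ _ _ _ (fun s : R => (s, x)) (fun h : R => (h, 0))).
by move=> h v s; congr pair; rewrite /= scaler0 add0r.
Qed.

Lemma derive_space F t x k : 'D_('e_k) (fun y => F (t, y)) x = Dx k F (t, x).
Proof.
apply: (@derive_comp_affine _ _ _ _ (fun y => (t, y)) (fun h => (0, h))).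
by move=> h v s; congr pair; rewrite /= scaler0 add0r.
Qed.

Lemma is_derive_time F t x : derivable F (t, x) ((1 : R), (0 : 'rV[R]_(m + 1))) ->
  is_derive t (1 : R) (fun s : R => F (s, x)) (Dt F (t, x)).
Proof.
move=> dF; split; last exact: derive_time.
have : derivable F (t, x) (1, 0) by [].
rewrite /derivable /=.
suff -> : (fun h : R => h^-1 *: (F (h *: (1, 0) + (t, x)) - F (t, x))) =
  fun h => h^-1 *: (F (h *: 1 + t, x) - F (t, x)) by [].
apply/funext => h; congr (_ *: (F _ - _)).
by congr pair; rewrite /= scaler0 add0r.
Qed.

Lemma compact_rsphere (r : R) : compact (@rsphere R m r).
Proof.
apply: bounded_closed_compact.
  exists `|r|; split; first exact: num_real.
  move=> M rM x xr /=.
  rewrite /Num.Def.normr /= mx_normrE; apply: bigmax_le => [|[i j] _] /=.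
    by apply: le_trans (ltW rM); exact: normr_ge0.
  apply: le_trans (ltW rM); rewrite (ord1 i) -xr [`|enorm x|]ger0_norm ?enorm_ge0 //.
  rewrite /enorm -sqrtr_sqr ler_wsqrtr // dotE (bigD1 j) //= -expr2 lerDl.
  by apply: sumr_ge0 => k _; rewrite -expr2 sqr_ge0.
rewrite (_ : rsphere r = (@enorm R (m + 1)) @^-1` [set r]).
  apply: closed_comp => [x _|]; last exact: closed_eq.
  apply: (@continuous_comp _ _ _ (fun z : 'rV[R]_(m + 1) => dot z z) (@Num.sqrt R)).
    exact: (differentiable_continuous (differentiable_dot_self x)).
  exact: sqrt_continuous.
by [].
Qed.

Lemma compact_bounded_on (T : topologicalType) (K : set T) (g : T -> R) : compact K ->
  (forall p, K p -> {for p, continuous g}) -> exists C, forall p, K p -> `|g p| <= C.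
Proof.
move=> cK cg.
have : compact (g @` K).
  apply: continuous_compact cK; apply: continuous_in_subspaceT => p /set_mem Kp.
  exact: cg.
move=> /compact_bounded [M [_ HM]]; exists (M + 1) => p Kp.
by apply: (HM (M + 1)); [rewrite ltrDl|exists p].
Qed.

Lemma differentiable_time_slice (t : R) x : differentiable (fun y => (t, y)) x.
Proof. by apply: differentiable_pair; [exact: differentiable_cst|exact: ex_diff]. Qed.

Lemma continuous_time_slice F eps t x : smooth_on (spacetime eps) F -> `|t| < eps -> x != 0 ->
  {for x, continuous (fun y => F (t, y))}.
Proof.
move=> sF te x0; apply: (@continuous_comp _ _ _ (fun y => (t, y)) F).
  exact: differentiable_continuous (differentiable_time_slice t x).
exact: (sF 0%N).
Qed.

Lemma spacetime_bounded F eps d (r : R) : 0 < r -> d < eps -> smooth_on (spacetime eps) F ->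
  exists C, forall t x, `|t| <= d -> rsphere r x -> `|F (t, x)| <= C.
Proof.
move=> r0 de sF.
have cK : compact (`[- d, d]%classic `*` @rsphere R m r).
  by apply: compact_setX; [exact: segment_compact|exact: compact_rsphere].
have [|C HC] := @compact_bounded_on _ _ F cK.
  move=> [t x] [/= td xr]; apply: (sF 0%N); split => /=.
    by apply: le_lt_trans de; rewrite ler_norml; move: td; rewrite in_itv.
  exact: rsphere_neq0 xr.
exists C => t x td xr; apply: HC; split => //=.
by rewrite in_itv /= -ler_norml.
Qed.

(** The integrand and its first two time derivatives are bounded on a compact cylinder
around the time a; multiplied by the volume density of the chart they satisfy the
hypotheses of the differentiation theorem for iterated integrals. *)
Lemma is_derive_sphere_integral (r eps a : R) F : 0 < r -> `|a| < eps ->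
  smooth_on (spacetime eps) F ->
  is_derive a (1 : R) (fun t => sphere_integral r (fun x => F (t, x)))
    (sphere_integral r (fun x => Dt F (a, x))).
Proof.
move=> r0 ae sF.
have sD : smooth_on (spacetime eps) (Dt F) by exact: smooth_on_derive.
have sDD : smooth_on (spacetime eps) (Dt (Dt F)) by exact: smooth_on_derive.
(* a closed time interval around a inside the open interval of definition *)
pose d := (`|a| + eps) / 2.
have ad : `|a| < d by rewrite /d; lra.
have de : d < eps by rewrite /d; lra.
have [C0 H0] := spacetime_bounded r0 de sF.
have [C1 H1] := spacetime_bounded r0 de sD.
have [C2 H2] := spacetime_bounded r0 de sDD.
pose C := Num.max C0 (Num.max C1 C2).
have {}H0 t x : `|t| <= d -> rsphere r x -> `|F (t, x)| <= C.
  by move=> td xr; rewrite /C le_max H0.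
have {}H1 t x : `|t| <= d -> rsphere r x -> `|Dt F (t, x)| <= C.
  by move=> td xr; rewrite /C !le_max H1 ?orbT.
have {}H2 t x : `|t| <= d -> rsphere r x -> `|Dt (Dt F) (t, x)| <= C.
  by move=> td xr; rewrite /C !le_max H2 ?orbT.
pose vol (u : 'rV[R]_m) := (2 * r / (1 + dot u u)) ^+ m.
have E G : (fun t : R => sphere_integral r (fun x => G (t, x))) =
    fun t => Rn_integral (fun u : 'rV[R]_m => vol u * G (t, stereo r u)).
  by apply/funext => t; rewrite sphere_integralE.
have Ea := congr1 (fun f => f a) (E (Dt F)).
rewrite E [X in is_derive _ _ _ X]Ea.
have dt G t u : smooth_on (spacetime eps) G -> `|t| <= d ->
    is_derive t (1 : R) (fun t : R => vol u * G (t, stereo r u)) (vol u * Dt G (t, stereo r u)).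
  move=> sG td.
  have := @is_derive_time G t (stereo r u).
  move=> /(_ (@smooth_on_derivable _ _ _ _ _ _ _ sG _)) => H.
  have {}H : is_derive t (1 : R) (fun s : R => G (s, stereo r u)) (Dt G (t, stereo r u)).
    apply: H; split; first exact: le_lt_trans td de.
    by apply: (@rsphere_neq0 _ _ r) => //; exact: stereo_rsphere.
  have := is_derive_mul (is_derive_cst (vol u) t (1 : R)) H.
  by rewrite mul0r add0r.
have cb G t : smooth_on (spacetime eps) G -> `|t| <= d ->
    (forall t x, `|t| <= d -> rsphere r x -> `|G (t, x)| <= C) ->
    cauchy_bounded (C * (2 * r) ^+ m) (fun u : 'rV[R]_m => vol u * G (t, stereo r u)).
  move=> sG td HG; apply: (@cauchy_bounded_stereo _ _ _ _ (fun x => G (t, x))) => //.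
    move=> x xr; apply: (continuous_time_slice sG); first exact: le_lt_trans td de.
    exact: rsphere_neq0 xr.
  by move=> x xr; exact: HG.
apply: (@is_derive_Rn_integral _ _ _ (fun t u => vol u * Dt F (t, stereo r u))
   (fun t u => vol u * Dt (Dt F) (t, stereo r u)) _ d (C * (2 * r) ^+ m)) => //.
- by move=> t td; exact: cb.
- by move=> t td; exact: cb.
- by move=> t u td; exact: dt.
- by move=> t u td; exact: dt.
- by move=> t u td; have [_] := cb _ t sDD td H2; exact.
Qed.

End spacetime.

(** * First variation of the stress at the small hypersphere *)

Section product_rule.
Context {R : realType} {V : normedModType R}.

Lemma derive_prod (f g : V -> R) (U : set V) x v : U x -> smooth_on U f -> smooth_on U g ->
  'D_v (fun y => f y * g y) x = 'D_v f x * g x + f x * 'D_v g x.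
Proof.
move=> Ux sf sg.
have Hf := derivableP (@smooth_on_derivable _ _ _ _ _ _ v sf Ux).
have Hg := derivableP (@smooth_on_derivable _ _ _ _ _ _ v sg Ux).
by have [_] := is_derive_mul Hf Hg.
Qed.

End product_rule.

Section laplacian_rules.
Context {R : realType} {m : nat}.
Implicit Types (f g : 'rV[R]_m -> R) (U : set 'rV[R]_m).

Lemma sum_delta (j : 'I_m) (a : 'I_m -> R) : \sum_k (j == k)%:R * a k = a j.
Proof.
rewrite (bigD1 j) //= eqxx mul1r big1 ?addr0 // => k /negbTE.
by rewrite eq_sym => ->; rewrite mul0r.
Qed.

Lemma sum_delta_l (j : 'I_m) (a : 'I_m -> R) : \sum_k (k == j)%:R * a k = a j.
Proof. by under eq_bigr do rewrite eq_sym; exact: sum_delta. Qed.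

Lemma laplacian_mul f g U x : open U -> U x -> smooth_on U f -> smooth_on U g ->
  laplacian (fun y => f y * g y) x =
  laplacian f x * g x + 2 * (\sum_k 'D_('e_k) f x * 'D_('e_k) g x) + f x * laplacian g x.
Proof.
move=> oU Ux sf sg; rewrite /laplacian mulr_suml !mulr_sumr -!big_split /=.
apply: eq_bigr => k _.
have -> : 'D_('e_k) ('D_('e_k) (fun y => f y * g y)) x =
    'D_('e_k) (fun y => 'D_('e_k) f y * g y + f y * 'D_('e_k) g y) x.
  apply: near_eq_derive; apply: filterS (open_nbhs_nbhs (conj oU Ux)) => y Uy.
  exact: (derive_prod _ Uy sf sg).
have sDf := smooth_on_derive 'e_k sf.
have sDg := smooth_on_derive 'e_k sg.
rewrite (@deriveD _ _ _ (fun y => 'D_('e_k) f y * g y) (fun y => f y * 'D_('e_k) g y)).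
- rewrite (derive_prod _ Ux sDf sg) (derive_prod _ Ux sf sDg).
  by rewrite addrA -[X in X + _]addrA -mulr2n mulr_natl.
- exact: (@smooth_on_derivable _ _ _ _ _ _ _ (smooth_onM oU sDf sg) Ux).
- exact: (@smooth_on_derivable _ _ _ _ _ _ _ (smooth_onM oU sf sDg) Ux).
Qed.

Lemma derive_affine f U x v (a b : R) : U x -> smooth_on U f ->
  'D_v (fun y => a * f y + b) x = a * 'D_v f x.
Proof.
move=> Ux sf.
have Hf := derivableP (@smooth_on_derivable _ _ _ _ _ _ v sf Ux).
have [_] := is_deriveD (is_derive_mul (is_derive_cst a x v) Hf) (is_derive_cst b x v).
by rewrite mul0r add0r addr0.
Qed.

Lemma laplacian_affine f U x (a b : R) : open U -> U x -> smooth_on U f ->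
  laplacian (fun y => a * f y + b) x = a * laplacian f x.
Proof.
move=> oU Ux sf; rewrite /laplacian mulr_sumr; apply: eq_bigr => k _.
transitivity ('D_('e_k) (fun y => a * 'D_('e_k) f y + 0) x).
  apply: near_eq_derive; apply: filterS (open_nbhs_nbhs (conj oU Ux)) => y Uy.
  by rewrite (derive_affine _ _ _ Uy sf) addr0.
by rewrite (derive_affine _ _ _ Ux (smooth_on_derive _ sf)).
Qed.

End laplacian_rules.

Section small_hypersphere.
Context {R : realType} {m : nat}.
Implicit Types (x y : 'rV[R]_(m + 1)).

Local Notation U := [set y : 'rV[R]_(m + 1) | y != 0].

Definition hypersphere_coord (c : 'I_(m + 1 + 1)) y : R := hypersphere 2^-1 (retr 2^-1 y) 0 c.

(** The height of the small hypersphere in the unit sphere; 2 kappa is its principal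
curvature sqrt 3. *)
Definition kappa : R := Num.sqrt (1 - 2^-1 ^+ 2).

Lemma kappa_sqr : kappa ^+ 2 = 3 / 4.
Proof. by rewrite sqr_sqrtr; [field|lra]. Qed.

Lemma hypersphere_coord_l j y : hypersphere_coord (lshift 1 j) y = 2^-1 / enorm y * y 0 j.
Proof. by rewrite /hypersphere_coord /hypersphere row_mxEl mxE. Qed.

Lemma hypersphere_coord_r i y : hypersphere_coord (rshift (m + 1) i) y = kappa.
Proof. by rewrite /hypersphere_coord /hypersphere row_mxEr mxE (ord1 i) mulr1n. Qed.

Lemma smooth_enorm k : smooth_on [set y : 'rV[R]_k | y != 0] (@enorm R k).
Proof.
apply: smooth_on_sqrt; first exact: open_neq0.
  by move=> x x0; rewrite dot_gt0.
by apply: smooth_on_dot_self; exact: open_neq0.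
Qed.

Lemma smooth_hypersphere_coord c : smooth_on U (hypersphere_coord c).
Proof.
have oU := @open_neq0 R (m + 1).
rewrite -[c]splitK; case: (fintype.split c) => j /=.
  rewrite (_ : hypersphere_coord _ = fun y => 2^-1 * (enorm y)^-1 * y 0 j); last first.
    by apply/funext => y; rewrite hypersphere_coord_l.
  apply: smooth_onM => //; last exact: smooth_on_coordinate.
  apply: smooth_onM => //; first exact: smooth_on_cst.
  apply: smooth_onV => //; last exact: smooth_enorm.
  by move=> y y0; rewrite gt_eqF // enorm_gt0.
rewrite (_ : hypersphere_coord _ = fun=> kappa); first exact: smooth_on_cst.
by apply/funext => y; rewrite hypersphere_coord_r.
Qed.

Lemma smooth_map_hypersphere : smooth_map 2^-1 1 (@hypersphere R m 2^-1).
Proof.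
have oU := @open_neq0 R (m + 1).
split; first by apply: smooth_on_row => // c; exact: smooth_hypersphere_coord.
move=> x xr; apply/rsphereP => //; rewrite /hypersphere dot_row_mx dot_scalar_mx.
by rewrite (rsphere_dot xr) -expr2 kappa_sqr; field.
Qed.

Let rho y := (enorm y)^-1.

Lemma dot_e y k : dot ('e_k) y = y 0 k.
Proof.
by rewrite dotE (eq_bigr (fun i => (i == k)%:R * y 0 i)) ?sum_delta_l // => i _; rewrite mxE.
Qed.

Let is_derive_rho y k : y != 0 -> is_derive y 'e_k rho (- y 0 k * rho y ^+ 3).
Proof.
move=> y0; have e0 : enorm y != 0 by rewrite gt_eqF // enorm_gt0.
have := is_derive_inv (is_derive_enorm 'e_k y0) e0.
by move/is_derive_eq; apply; rewrite dot_e /rho; field.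
Qed.

Let is_derive_coordinate y k j : is_derive y 'e_k (fun z : 'rV[R]_(m + 1) => z 0 j) (j == k)%:R.
Proof.
have := (is_derive_coord _ _ _ _).1 (is_derive_id y 'e_k) j.
by move/is_derive_eq; apply; rewrite mxE.
Qed.

Let D1 j k y := 2^-1 * ((j == k)%:R * rho y - y 0 j * (y 0 k * (rho y * (rho y * rho y)))).

Let is_derive_hypersphere_coord j k y : y != 0 ->
  is_derive y 'e_k (hypersphere_coord (lshift 1 j)) (D1 j k y).
Proof.
move=> y0; have H := is_derive_mul (is_derive_mul (is_derive_cst (2^-1 : R) y 'e_k)
  (is_derive_rho k y0)) (is_derive_coordinate y k j).
have -> : hypersphere_coord (lshift 1 j) = fun y => 2^-1 * rho y * y 0 j.
  by apply/funext => z; rewrite hypersphere_coord_l.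
by refine (is_derive_eq H _); rewrite /D1 /cst; ring.
Qed.

Let derive_D1 j k y : y != 0 -> 'D_('e_k) (D1 j k) y =
  2^-1 * (- (j == k)%:R * y 0 k * rho y ^+ 3 * 2 - y 0 j * rho y ^+ 3
    + 3 * y 0 j * y 0 k ^+ 2 * rho y ^+ 5).
Proof.
move=> y0; have Hr := is_derive_rho k y0.
have Hrr := is_derive_mul Hr (is_derive_mul Hr Hr).
have Ha := is_derive_mul (is_derive_cst ((j == k)%:R : R) y 'e_k) Hr.
have Hb := is_derive_mul (is_derive_coordinate y k j)
  (is_derive_mul (is_derive_coordinate y k k) Hrr).
have [_ E] := is_derive_mul (is_derive_cst (2^-1 : R) y 'e_k) (is_deriveB Ha Hb).
rewrite [LHS]E /cst eqxx !mul0r !add0r mulr1n; move: ((j == k)%:R : R) => b; ring.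
Qed.

Section at_point.
Variable x : 'rV[R]_(m + 1).
Hypothesis xr : rsphere 2^-1 x.

Let x0 : x != 0. Proof. by apply: rsphere_neq0 xr. Qed.
Let rho2 : rho x = 2. Proof. by rewrite /rho xr invrK. Qed.
Let sumx2 : \sum_k x 0 k ^+ 2 = 1 / 4.
Proof.
have := rsphere_dot xr; rewrite dotE => E.
by rewrite (eq_bigr (fun k => x 0 k * x 0 k)) ?E //; field.
Qed.

Lemma derive_hypersphere_coord_l j k : 'D_('e_k) (hypersphere_coord (lshift 1 j)) x = (j == k)%:R - 4 * x 0 j * x 0 k.
Proof. by have [_ ->] := is_derive_hypersphere_coord j k x0; rewrite /D1 rho2; field. Qed.

Lemma derive_hypersphere_coord_r i k : 'D_('e_k) (hypersphere_coord (rshift (m + 1) i)) x = 0.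
Proof.
rewrite (_ : hypersphere_coord _ = cst kappa) ?derive_cst //.
by apply/funext => y; rewrite hypersphere_coord_r.
Qed.

Lemma laplacian_hypersphere_coord_l j : laplacian (hypersphere_coord (lshift 1 j)) x = - 4 * m%:R * x 0 j.
Proof.
rewrite /laplacian.
rewrite (eq_bigr (fun k => (j == k)%:R * (- 8 * x 0 k) + (- 4 * x 0 j + 48 * x 0 j * x 0 k ^+ 2))).
  rewrite big_split sum_delta big_split /= sumr_const card_ord -mulr_sumr sumx2.
  by rewrite -[_ *+ (m + 1)]mulr_natr natrD; field.
move=> k _; transitivity ('D_('e_k) (D1 j k) x); last first.
  by rewrite derive_D1 // rho2; field.
apply: near_eq_derive; apply: filterS (near_neq0 x0) => y y0.
by have [_ ->] := is_derive_hypersphere_coord j k y0.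
Qed.

Lemma laplacian_hypersphere_coord_r i : laplacian (hypersphere_coord (rshift (m + 1) i)) x = 0.
Proof.
rewrite /laplacian big1 // => k _.
rewrite (_ : 'D_('e_k) (hypersphere_coord _) = cst 0) ?derive_cst //.
apply/funext => y; rewrite (_ : hypersphere_coord _ = cst kappa) ?derive_cst //.
by apply/funext => z; rewrite hypersphere_coord_r.
Qed.

Lemma hypersphere_coord_x j : hypersphere_coord (lshift 1 j) x = x 0 j.
Proof. by rewrite hypersphere_coord_l xr divff ?mul1r // invr_eq0. Qed.

(** The tension field of the isometric inclusion is normal. *)
Lemma sum_derive_laplacian k :
  \sum_c 'D_('e_k) (hypersphere_coord c) x * laplacian (hypersphere_coord c) x = 0.
Proof.
rewrite big_split_ord /= [X in _ + X]big1 ?addr0; last first.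
  by move=> i _; rewrite derive_hypersphere_coord_r mul0r.
rewrite (eq_bigr (fun j => (j == k)%:R * (- 4 * m%:R * x 0 j) + 16 * m%:R * x 0 k * x 0 j ^+ 2)).
  by rewrite big_split /= sum_delta_l -mulr_sumr sumx2; field.
by move=> j _; rewrite derive_hypersphere_coord_l laplacian_hypersphere_coord_l; ring.
Qed.

(** The inclusion is isometric: the induced metric is the projection orthogonal to x,
as |x|^2 = 1/4. *)
Lemma sum_derive_derive k l :
  \sum_c 'D_('e_k) (hypersphere_coord c) x * 'D_('e_l) (hypersphere_coord c) x = (k == l)%:R - 4 * x 0 k * x 0 l.
Proof.
rewrite big_split_ord /= [X in _ + X]big1 ?addr0; last first.
  by move=> i _; rewrite derive_hypersphere_coord_r mul0r.
rewrite (eq_bigr (fun j => (j == k)%:R * ((j == l)%:R - 4 * x 0 j * x 0 l) +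
   ((j == l)%:R * (- 4 * x 0 j * x 0 k) + 16 * x 0 k * x 0 l * x 0 j ^+ 2))).
  by rewrite big_split /= sum_delta_l big_split /= sum_delta_l -mulr_sumr sumx2; field.
by move=> j _; rewrite !derive_hypersphere_coord_l; ring.
Qed.

(** On the sphere of radius 1/2 these are the coordinates of the vector
2 (-kappa phi + e), with e the last basis vector: twice the component of e orthogonal
to phi and to the tangent space. Its norm is 1, since the last coordinate of phi is
kappa and 4 (1 - kappa^2) = 1; so it is a unit normal. *)
Definition normal_coord c y : R := - 2 * kappa * hypersphere_coord c y + 2 * (c == rshift (m + 1) ord0)%:R.

Lemma normal_coord_l j : normal_coord (lshift 1 j) x = - 2 * kappa * x 0 j.
Proof. by rewrite /normal_coord hypersphere_coord_x eq_lrshift mulr0 addr0. Qed.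

Lemma sum_derive_normal k : \sum_c 'D_('e_k) (hypersphere_coord c) x * normal_coord c x = 0.
Proof.
rewrite big_split_ord /= [X in _ + X]big1 ?addr0; last first.
  by move=> i _; rewrite derive_hypersphere_coord_r mul0r.
rewrite (eq_bigr (fun j => (j == k)%:R * (- 2 * kappa * x 0 j) + 8 * kappa * x 0 k * x 0 j ^+ 2)).
  by rewrite big_split /= sum_delta_l -mulr_sumr sumx2; field.
by move=> j _; rewrite derive_hypersphere_coord_l normal_coord_l; ring.
Qed.

(** The mean curvature: m times the principal curvature. *)
Lemma sum_normal_laplacian :
  \sum_c normal_coord c x * laplacian (hypersphere_coord c) x = 2 * kappa * m%:R.
Proof.
rewrite big_split_ord /= [X in _ + X]big1 ?addr0; last first.
  by move=> i _; rewrite laplacian_hypersphere_coord_r mulr0.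
rewrite (eq_bigr (fun j => 8 * kappa * m%:R * x 0 j ^+ 2)).
  by rewrite -mulr_sumr sumx2; field.
by move=> j _; rewrite laplacian_hypersphere_coord_l normal_coord_l; ring.
Qed.

(** In the product rule for the Laplacian of psi times the normal, the terms without a
derivative of psi, and the one with its Laplacian, vanish by orthogonality of
tangent and normal vectors. Of what remains, D_k psi <N, Lap phi> contributes
m times the principal curvature, and the cross term -2 times the same, both
in factor of D_k psi. *)
Lemma stress_normal_variation (psi : 'rV[R]_(m + 1) -> R) k :
  smooth_on U psi -> \sum_j x 0 j * 'D_('e_j) psi x = 0 ->
  \sum_c ('D_('e_k) (fun y => psi y * normal_coord c y) x * laplacian (hypersphere_coord c) x
    + 'D_('e_k) (hypersphere_coord c) x * laplacian (fun y => psi y * normal_coord c y) x) =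
  2 * kappa * (m%:R - 2) * 'D_('e_k) psi x.
Proof.
move=> sp px; have oU := @open_neq0 R (m + 1).
have sN c : smooth_on U (normal_coord c).
  apply: smooth_onD => //; last exact: smooth_on_cst.
  by apply: smooth_onM => //; [exact: smooth_on_cst|exact: smooth_hypersphere_coord].
have DN c j : 'D_('e_j) (normal_coord c) x = - 2 * kappa * 'D_('e_j) (hypersphere_coord c) x.
  exact: (derive_affine _ _ _ x0 (@smooth_hypersphere_coord c)).
have LN c : laplacian (normal_coord c) x = - 2 * kappa * laplacian (hypersphere_coord c) x.
  exact: (laplacian_affine _ _ oU x0 (@smooth_hypersphere_coord c)).
pose d c j := 'D_('e_j) (hypersphere_coord c) x.
pose L c := laplacian (hypersphere_coord c) x.
have E c : 'D_('e_k) (fun y => psi y * normal_coord c y) x * L c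
    + d c k * laplacian (fun y => psi y * normal_coord c y) x =
    'D_('e_k) psi x * (normal_coord c x * L c) + (- 4 * kappa * psi x) * (d c k * L c) +
    laplacian psi x * (d c k * normal_coord c x) +
    (- 4 * kappa) * \sum_j 'D_('e_j) psi x * (d c k * d c j).
  rewrite (derive_prod _ x0 sp (sN c)) (laplacian_mul oU x0 sp (sN c)) DN LN.
  have -> : \sum_j 'D_('e_j) psi x * (d c k * d c j) = d c k * \sum_j 'D_('e_j) psi x * d c j.
    by rewrite mulr_sumr; apply: eq_bigr => j _; rewrite mulrCA.
  have -> : \sum_j 'D_('e_j) psi x * 'D_('e_j) (normal_coord c) x =
      - 2 * kappa * \sum_j 'D_('e_j) psi x * d c j.
    by rewrite mulr_sumr; apply: eq_bigr => j _; rewrite DN mulrCA.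
  rewrite -/(d c k) -/(L c); ring.
under eq_bigr => c _ do rewrite E.
rewrite !big_split /= -!mulr_sumr sum_normal_laplacian sum_derive_laplacian sum_derive_normal.
rewrite exchange_big /=.
under eq_bigr => j _ do rewrite -mulr_sumr sum_derive_derive.
rewrite (eq_bigr (fun j => (k == j)%:R * 'D_('e_j) psi x
    - 4 * x 0 k * (x 0 j * 'D_('e_j) psi x))).
  rewrite sumrB sum_delta -mulr_sumr px.
  by move: ('D_('e_k) psi x) (laplacian psi x) (psi x) => a b c; ring.
by move=> j _; move: ('D_('e_j) psi x) => a; ring.
Qed.

End at_point.
End small_hypersphere.

(** * Pointwise identities on the small hypersphere *)

Section squares.
Context {R : realType} {V : normedModType R}.

Lemma derive_sum_seq (I : Type) (s : seq I) (f : I -> V -> R) (U : set V) x v : U x ->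
  open U -> (forall i, smooth_on U (f i)) ->
  'D_v (fun y => \sum_(i <- s) f i y) x = \sum_(i <- s) 'D_v (f i) x.
Proof.
move=> Ux oU sf; elim: s => [|i s IH].
  rewrite big_nil; under eq_fun do rewrite big_nil.
  exact: (derive_cst (0 : R)).
rewrite big_cons; under eq_fun do rewrite big_cons.
rewrite (@deriveD _ _ _ (f i) (fun y => \sum_(j <- s) f j y)) ?IH //.
  exact: (@smooth_on_derivable _ _ _ _ _ _ _ (sf i) Ux).
exact: (@smooth_on_derivable _ _ _ _ _ _ _ (smooth_on_sum _ oU sf) Ux).
Qed.

Lemma derive_sqr_zero (f : V -> R) (U : set V) x v : U x -> smooth_on U f -> f x = 0 ->
  'D_v (fun y => f y * f y) x = 0.
Proof. by move=> Ux sf f0; rewrite (derive_prod _ Ux sf sf) f0 mulr0 mul0r addr0. Qed.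

(** At a zero of f the second derivative of f^2 only sees the first derivative of f;
so the Hessian of the functional needs no second variation of the map. *)
Lemma derive2_sqr_zero (f : V -> R) (U : set V) x v : open U -> U x -> smooth_on U f ->
  f x = 0 -> 'D_v ('D_v (fun y => f y * f y)) x = 2 * 'D_v f x ^+ 2.
Proof.
move=> oU Ux sf f0.
have sD := smooth_on_derive v sf.
transitivity ('D_v (fun y => 'D_v f y * f y + f y * 'D_v f y) x).
  apply: near_eq_derive; apply: filterS (open_nbhs_nbhs (conj oU Ux)) => y Uy.
  exact: (derive_prod _ Uy sf sf).
rewrite (@deriveD _ _ _ (fun y => 'D_v f y * f y) (fun y => f y * 'D_v f y)).
- rewrite (derive_prod _ Ux sD sf) (derive_prod _ Ux sf sD) f0 mulr0 mul0r add0r addr0.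
  by rewrite expr2 mulr_natl mulr2n.
- exact: (@smooth_on_derivable _ _ _ _ _ _ _ (smooth_onM oU sD sf) Ux).
- exact: (@smooth_on_derivable _ _ _ _ _ _ _ (smooth_onM oU sf sD) Ux).
Qed.

End squares.

Section spatial_identities.
Context {R : realType} {m : nat}.
Variable x : 'rV[R]_(m + 1).
Hypothesis xr : rsphere 2^-1 x.
Let x0 : x != 0. Proof. by apply: rsphere_neq0 xr. Qed.

(** The vectors D_k phi form, at x, the orthogonal projection onto the tangent space:
its trace m and its action on the tangent vector a give m |a|^2 - |a|^2, twice. *)
Lemma sum_wedge_sqr (a : 'I_(m + 1) -> R) : \sum_k x 0 k * a k = 0 ->
  \sum_k \sum_l \sum_c (a l * 'D_('e_k) (hypersphere_coord c) x - a k * 'D_('e_l) (hypersphere_coord c) x) ^+ 2 =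
  2 * (m%:R - 1) * \sum_k a k ^+ 2.
Proof.
move=> xa.
pose G k l := (k == l)%:R - 4 * x 0 k * x 0 l.
have E k l : \sum_c (a l * 'D_('e_k) (hypersphere_coord c) x - a k * 'D_('e_l) (hypersphere_coord c) x) ^+ 2 =
   G k k * a l ^+ 2 + a k ^+ 2 * G l l - 2 * (a k * (a l * G k l)).
  rewrite /G -!(sum_derive_derive xr) !mulr_sumr !mulr_suml -big_split -sumrB.
  apply: eq_bigr => c _ /=.
  by move: ('D_('e_k) (hypersphere_coord c) x) ('D_('e_l) (hypersphere_coord c) x) => u v; ring.
have trG : \sum_k G k k = m%:R.
  rewrite /G sumrB (eq_bigr (fun=> 1)); last by move=> k _; rewrite eqxx.
  rewrite sumr_const card_ord.
  have -> : \sum_k 4 * x 0 k * x 0 k = 1.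
    under eq_bigr do rewrite -mulrA.
    by rewrite -mulr_sumr -dotE (rsphere_dot xr); field.
  by rewrite natrD addrK.
under eq_bigr => k _ do under eq_bigr => l _ do rewrite E.
under eq_bigr => k _ do rewrite sumrB big_split /= -!mulr_sumr trG.
rewrite sumrB big_split /= -!mulr_suml trG -mulr_sumr.
have -> : \sum_k a k * (\sum_l a l * G k l) = \sum_k a k ^+ 2.
  apply: eq_bigr => k _; rewrite expr2; congr (_ * _).
  rewrite (eq_bigr (fun l => (k == l)%:R * a l - 4 * x 0 k * (x 0 l * a l))).
    by rewrite sumrB sum_delta -mulr_sumr xa mulr0 subr0.
  by move=> l _; rewrite /G; ring.
ring.
Qed.

Lemma gradient_sqr (f : 'rV[R]_(m + 1) -> R) : smooth_sphere 2^-1 f ->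
  enorm (gradient 2^-1 f x) ^+ 2 = \sum_k 'D_('e_k) (fun y => f (retr 2^-1 y)) x ^+ 2.
Proof.
move=> sf; rewrite enorm_sqr /gradient.
have [ee _] := frameP x0.
have fr i j : dot (frame_vec x i) (frame_vec x j) = (i == j)%:R.
  have := congr1 (fun M : 'M[R]_m => M i j) ee; rewrite !mxE => <-.
  by rewrite dotE; apply: eq_bigr => k _; rewrite !mxE.
set g := fun i => sdiff 2^-1 f x (frame_vec x i).
have -> : dot (\sum_i g i *: frame_vec x i) (\sum_i g i *: frame_vec x i) = \sum_i g i ^+ 2.
  have dsum (w : 'rV[R]_(m + 1)) (h : 'I_m -> 'rV[R]_(m + 1)) :
      dot (\sum_i h i) w = \sum_i dot (h i) w.
    by rewrite (big_morph (fun u => dot u w) (fun u v => dotDl u v w) (dot0l w)).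
  rewrite dsum; apply: eq_bigr => i _.
  rewrite dotZl dotC dsum expr2; congr (_ * _).
  under eq_bigr => j _ do rewrite dotZl fr mulrC.
  exact: sum_delta_l.
have gE i : g i = \sum_k frame_vec x i 0 k * 'D_('e_k) (fun y => f (retr 2^-1 y)) x.
  by rewrite /g /sdiff (derive_basis _ (smooth_on_differentiable sf x0)).
under eq_bigr do rewrite gE.
apply: frame_sum_sqr => //.
transitivity ('D_x (fun y => f (retr 2^-1 y)) x).
  by rewrite (derive_basis _ (smooth_on_differentiable sf x0)).
by apply: derive_homog0 => c z c0; rewrite retrZ.
Qed.

End spatial_identities.

Section unit_normal.
Context {R : realType} {m : nat} (nu : 'rV[R]_(m + 1) -> 'rV[R]_(m + 1 + 1)).
Hypothesis hnu : unit_normal 2^-1 (@hypersphere R m 2^-1) nu.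

Let last_idx : 'I_(m + 1 + 1) := rshift (m + 1) ord0.

Let r0 : 0 < 2^-1 :> R. Proof. by []. Qed.

(** A unit vector normal to the hypersphere and tangent to the unit sphere has its first
block proportional to x and is determined by its last coordinate, which is +-1/2. *)
Lemma unit_normalE x : rsphere 2^-1 x ->
  nu x 0 last_idx ^+ 2 = 4^-1 /\ forall c, nu x 0 c = 2 * nu x 0 last_idx * normal_coord c x.
Proof.
move=> xr; have x0 := rsphere_neq0 r0 xr; have [_ /(_ x xr)[nt n1 nd]] := hnu.
have xx := rsphere_dot xr.
pose a := lsubmx (nu x); pose b := nu x 0 last_idx.
have nuE : nu x = row_mx a (b%:M : 'rV[R]_1).
  rewrite -[LHS]hsubmxK -/a; congr row_mx.
  by apply/rowP => i; rewrite (ord1 i) !mxE eqxx mulr1n /b.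
have Dphi v : dot v x = 0 -> sdiff 2^-1 (@hypersphere R m 2^-1) x v = row_mx v 0.
  move=> vx; have H1 := is_derive_mul (is_derive_cst (2^-1 : R) x v)
     (is_derive_inv (is_derive_enorm v x0) (_ : enorm x != 0)).
  have {}H1 : is_derive x v (fun z => 2^-1 / enorm z) 0.
    have e0 : enorm x != 0 by rewrite xr gt_eqF.
    by move/is_derive_eq: (H1 e0); apply; rewrite vx !(mul0r, oppr0, mulr0, addr0).
  have H2 := is_derive_scale H1 (is_derive_id x v).
  have H3 := is_derive_row_mx H2 (is_derive_cst (kappa%:M : 'rV[R]_1) x v).
  have [_ E] := H3; rewrite /sdiff [LHS]E.
  by rewrite scale0r add0r xr divff ?scale1r // gt_eqF.
have at_ v : dot v x = 0 -> dot a v = 0.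
  by move=> vx; have := nd v vx; rewrite Dphi // nuE dot_row_mx (dotC _ 0) dot0l addr0.
have aE : a = (4 * dot a x) *: x.
  apply/eqP; rewrite -subr_eq0 -/(tproj x a).
  have -> : a - (4 * dot a x) *: x = tproj x a.
    by rewrite /tproj xx; congr (_ - _ *: _); field.
  rewrite -dot_eq0 {1}/tproj dotDl dotNl dotZl (dotC x (tproj x a)) tproj_tangent // mulr0 subr0.
  by rewrite at_ // tproj_tangent.
have k0 := kappa_sqr (R := R).
have axb : dot a x + b * kappa = 0.
  by move: nt; rewrite /rtangent /= nuE /hypersphere dot_row_mx dot_scalar_mx.
have a4 : dot a x = - (b * kappa) by apply/eqP; rewrite -addr_eq0 axb.
have b2 : b ^+ 2 = 4^-1.
  have : dot (nu x) (nu x) = 1 by rewrite -enorm_sqr n1 expr1n.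
  rewrite nuE dot_row_mx dot_scalar_mx aE !dotP xx a4 => E.
  have : 4 * b ^+ 2 * kappa ^+ 2 + b ^+ 2 = 1 by rewrite -[RHS]E; field.
  by rewrite k0 => {}E; lra.
split=> // c; rewrite -/b {1}nuE -[c]splitK; case: (fintype.split c) => j /=.
  by rewrite row_mxEl normal_coord_l // aE a4 mxE; ring.
rewrite row_mxEr mxE (ord1 j) eqxx mulr1n /normal_coord hypersphere_coord_r eqxx.
have -> : 2 * b * (- 2 * kappa * kappa + 2 * true%:R) = 4 * b * (1 - kappa ^+ 2) by rewrite mulr1n; ring.
by rewrite k0; field.
Qed.

Variable f : 'rV[R]_(m + 1) -> R.
Hypothesis sf : smooth_sphere 2^-1 f.

(** The function f up to the choice of sign made by nu at each point. It is smooth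
because the last coordinate of nu is, which avoids deciding whether the sign is
constant. *)
Definition normal_factor (y : 'rV[R]_(m + 1)) : R :=
  2 * f (retr 2^-1 y) * nu (retr 2^-1 y) 0 last_idx.

Lemma smooth_normal_factor : smooth_on [set y : 'rV[R]_(m + 1) | y != 0] normal_factor.
Proof.
have oU := @open_neq0 R (m + 1); have [snu _] := hnu.
apply: smooth_onM => //; first by apply: smooth_onM => //; exact: smooth_on_cst.
exact: (smooth_on_coord last_idx oU snu).
Qed.

Lemma normal_factorE y c : y != 0 ->
  f (retr 2^-1 y) * nu (retr 2^-1 y) 0 c = normal_factor y * normal_coord c y.
Proof.
move=> y0; have [_ ->] := unit_normalE (retr_rsphere r0 y0).
have -> : normal_coord c (retr 2^-1 y) = normal_coord c y.
  by rewrite /normal_coord /hypersphere_coord (retr_id r0 (retr_rsphere r0 y0)).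
by rewrite /normal_factor; ring.
Qed.

Lemma derive_normal_factor_radial (x : 'rV[R]_(m + 1)) : x != 0 ->
  \sum_k x 0 k * 'D_('e_k) normal_factor x = 0.
Proof.
move=> x0; transitivity ('D_x normal_factor x).
  by rewrite (derive_basis _ (smooth_on_differentiable smooth_normal_factor x0)).
by apply: derive_homog0 => c z c0; rewrite /normal_factor retrZ.
Qed.

(** The last coordinate of nu has constant square 1/4, so its derivative vanishes. *)
Lemma derive_normal_factor_sqr (x : 'rV[R]_(m + 1)) k : x != 0 ->
  'D_('e_k) normal_factor x ^+ 2 = 'D_('e_k) (fun y => f (retr 2^-1 y)) x ^+ 2.
Proof.
move=> x0; have oU := @open_neq0 R (m + 1); have [snu _] := hnu.
pose b y := nu (retr 2^-1 y) 0 last_idx.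
have sb : smooth_on [set y : 'rV[R]_(m + 1) | y != 0] b by exact: (smooth_on_coord last_idx oU snu).
have b2 y : y != 0 -> b y * b y = 4^-1.
  by move=> y0; have [<- _] := unit_normalE (retr_rsphere r0 y0).
have Db : 'D_('e_k) b x = 0.
  have : 'D_('e_k) (fun y => b y * b y) x = 0.
    rewrite -[RHS](derive_cst (4^-1 : R) x 'e_k); apply: near_eq_derive.
    by apply: filterS (near_neq0 x0) => y; exact: b2.
  rewrite (derive_prod _ x0 sb sb) mulrC -mulr2n => /eqP; rewrite mulrn_eq0 /= mulf_eq0.
  case/orP => /eqP // bx; have := b2 _ x0; rewrite bx mul0r => /esym/eqP.
  by rewrite invr_eq0 pnatr_eq0.
have s2f : smooth_on [set y : 'rV[R]_(m + 1) | y != 0] (fun y => 2 * f (retr 2^-1 y)).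
  by apply: smooth_onM => //; exact: smooth_on_cst.
rewrite /normal_factor (derive_prod _ x0 s2f sb) Db mulr0 addr0.
rewrite (derive_prod _ x0 (@smooth_on_cst _ _ _ _ (2 : R)) sf) derive_cst mul0r add0r.
rewrite exprMn [X in _ * X]expr2 b2 // exprMn; by field.
Qed.

End unit_normal.

(** * The density along a variation *)

Section variation.
Context {R : realType} {m : nat} (Phi : R -> 'rV[R]_(m + 1) -> 'rV[R]_(m + 1 + 1)) (eps : R).
Implicit Types (x y : 'rV[R]_(m + 1)) (p : R * 'rV[R]_(m + 1)).
Hypothesis eps0 : 0 < eps.
Hypothesis sPhi : smooth_on (spacetime eps)
  (fun p : R * 'rV[R]_(m + 1) => Phi p.1 (retr 2^-1 p.2)).
Hypothesis Phi1 : forall t x, `|t| < eps -> rsphere 2^-1 x -> rsphere 1 (Phi t x).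
Hypothesis Phi0 : forall x, rsphere 2^-1 x -> Phi 0 x = hypersphere 2^-1 x.

Let r0 : 0 < 2^-1 :> R. Proof. by []. Qed.
Let oS : open (spacetime eps : set (R * 'rV[R]_(m + 1))) := @open_spacetime R m eps.

Definition vcoord (c : 'I_(m + 1 + 1)) p : R := Phi p.1 (retr 2^-1 p.2) 0 c.

Definition vstress (k : 'I_(m + 1)) p : R :=
  \sum_c Dx k (vcoord c) p * \sum_j Dx j (Dx j (vcoord c)) p.

(** The vectors a_l D_k W - a_k D_l W whose squared norms add up to the density. *)
Definition vwedge (i : ('I_(m + 1) * 'I_(m + 1)) * 'I_(m + 1 + 1)) p : R :=
  vstress i.1.2 p * Dx i.1.1 (vcoord i.2) p - vstress i.1.1 p * Dx i.1.2 (vcoord i.2) p.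

Definition vdensity p : R := \sum_i vwedge i p * vwedge i p.

Lemma smooth_vcoord c : smooth_on (spacetime eps) (vcoord c).
Proof. exact: (smooth_on_coord c oS sPhi). Qed.

Lemma smooth_Dx k (F : R * 'rV[R]_(m + 1) -> R) : smooth_on (spacetime eps) F -> smooth_on (spacetime eps) (Dx k F).
Proof. exact: smooth_on_derive. Qed.

Lemma smooth_vstress k : smooth_on (spacetime eps) (vstress k).
Proof.
apply: smooth_on_sum => // c; apply: smooth_onM => //.
  by apply: smooth_Dx; exact: smooth_vcoord.
by apply: smooth_on_sum => // j; do 2!apply: smooth_Dx; exact: smooth_vcoord.
Qed.

Lemma smooth_vwedge i : smooth_on (spacetime eps) (vwedge i).
Proof.
apply: smooth_onB => //; apply: smooth_onM => //;
  by [exact: smooth_vstress|apply: smooth_Dx; exact: smooth_vcoord].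
Qed.

Lemma smooth_vdensity : smooth_on (spacetime eps) vdensity.
Proof.
by apply: smooth_on_sum => // i; apply: smooth_onM => //; exact: smooth_vwedge.
Qed.

Lemma sum_vwedge p : vdensity p = \sum_k \sum_l \sum_c
  (vstress l p * Dx k (vcoord c) p - vstress k p * Dx l (vcoord c) p) ^+ 2.
Proof.
rewrite pair_bigA /= pair_bigA /=.
by apply: eq_bigr => i _; rewrite -expr2.
Qed.

Lemma smooth_map_variation t : `|t| < eps -> smooth_map 2^-1 1 (Phi t).
Proof.
move=> te; split; last by move=> x; exact: Phi1.
have := @smooth_on_comp_affine R 'rV[R]_(m + 1) _ _ (spacetime eps)
  (fun y => (t, y)) (fun h => (0, h)) _ _ (differentiable_time_slice t) sPhi.
rewrite (_ : _ @^-1` _ = [set y | y != 0]).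
  by apply=> h v s; congr pair; rewrite /= scaler0 add0r.
by apply/seteqP; split => y /= => [[]|].
Qed.

Lemma E4_density_variation t x : `|t| < eps -> rsphere 2^-1 x ->
  E4_density 2^-1 1 (Phi t) x = vdensity (t, x).
Proof.
move=> te xr; rewrite (E4_densityE r0 (smooth_map_variation te) xr) sum_vwedge.
have D c y k : 'D_('e_k) (fun y => Phi t (retr 2^-1 y) 0 c) y = Dx k (vcoord c) (t, y).
  exact: derive_space.
have Lp c : laplacian (fun y => Phi t (retr 2^-1 y) 0 c) x = \sum_j Dx j (Dx j (vcoord c)) (t, x).
  rewrite /laplacian; apply: eq_bigr => j _.
  rewrite (_ : 'D_('e_j) (fun y => Phi t (retr 2^-1 y) 0 c) = fun y => Dx j (vcoord c) (t, y)).
    exact: derive_space.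
  by apply/funext => y; exact: D.
have St k : stress 2^-1 (Phi t) x k = vstress k (t, x).
  rewrite /stress /vstress; apply: eq_bigr => c _.
  by rewrite (D c x k) (Lp c).
apply: eq_bigr => k _; apply: eq_bigr => l _; apply: eq_bigr => c _.
by rewrite (St k) (St l) (D c x k) (D c x l).
Qed.

Lemma hatE4_variation t : `|t| < eps ->
  hatE4 2^-1 1 (Phi t) = 4^-1 * sphere_integral 2^-1 (fun x => vdensity (t, x)).
Proof.
move=> te; congr (_ * _); apply: sphere_integral_ext => // x xr.
exact: E4_density_variation.
Qed.

Lemma near_time (a : R) : `|a| < eps -> \forall t \near a, `|t| < eps.
Proof.
move=> ae; have oE : open [set t : R | `|t| < eps].
  apply: (@open_comp _ _ (fun t : R => `|t|) [set t | t < eps]) => [t _|].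
    exact: norm_continuous.
  exact: open_lt.
exact: (open_nbhs_nbhs (conj oE ae)).
Qed.

Lemma is_derive_hatE4 a : `|a| < eps -> is_derive a (1 : R) (fun t => hatE4 2^-1 1 (Phi t))
  (4^-1 * sphere_integral 2^-1 (fun x => Dt vdensity (a, x))).
Proof.
move=> ae; have H := is_derive_sphere_integral r0 ae smooth_vdensity.
have := is_derive_mul (is_derive_cst (4^-1 : R) a (1 : R)) H.
rewrite mul0r add0r; apply: near_eq_is_derive.
by apply: filterS (near_time ae) => t te; rewrite hatE4_variation.
Qed.

(** The functional is differentiable at all small times, so its derivative is, near 0,
again an integral over the sphere depending on t, of the same type. *)
Lemma is_derive_derive1_hatE4 : is_derive (0 : R) (1 : R) (derive1 (fun t => hatE4 2^-1 1 (Phi t)))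
  (4^-1 * sphere_integral 2^-1 (fun x => Dt (Dt vdensity) (0, x))).
Proof.
have z0 : `|0 : R| < eps by rewrite normr0.
have sD : smooth_on (spacetime eps) (Dt vdensity) by exact: smooth_on_derive smooth_vdensity.
have H := is_derive_sphere_integral r0 z0 sD.
have := is_derive_mul (is_derive_cst (4^-1 : R) 0 (1 : R)) H.
rewrite mul0r add0r; apply: near_eq_is_derive.
apply: filterS (near_time z0) => t te.
by have [_ E] := is_derive_hatE4 te; rewrite derive1E E.
Qed.

Section at_zero.
Variable x : 'rV[R]_(m + 1).
Hypothesis xr : rsphere 2^-1 x.
Let x0 : x != 0. Proof. by apply: rsphere_neq0 xr. Qed.

Let z0 : `|0 : R| < eps. Proof. by rewrite normr0. Qed.
Let S0 y : y != 0 -> spacetime eps (0, y). Proof. by []. Qed.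

Lemma vcoord0 c y : y != 0 -> vcoord c (0, y) = hypersphere_coord c y.
Proof. by move=> y0; rewrite /vcoord /= Phi0 //; exact: retr_rsphere. Qed.

Lemma Dx_vcoord0 c k y : y != 0 -> Dx k (vcoord c) (0, y) = 'D_('e_k) (hypersphere_coord c) y.
Proof.
move=> y0; rewrite -derive_space; apply: near_eq_derive.
by apply: filterS (near_neq0 y0) => z; exact: vcoord0.
Qed.

Lemma laplacian_vcoord0 c : \sum_j Dx j (Dx j (vcoord c)) (0, x) = laplacian (hypersphere_coord c) x.
Proof.
apply: eq_bigr => j _; rewrite -derive_space; apply: near_eq_derive.
by apply: filterS (near_neq0 x0) => z; exact: Dx_vcoord0.
Qed.

Lemma vstress0 k : vstress k (0, x) = 0.
Proof.
rewrite -[RHS](sum_derive_laplacian xr k); apply: eq_bigr => c _.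
by rewrite (Dx_vcoord0 c k x0) (laplacian_vcoord0 c).
Qed.

Lemma vwedge0 i : vwedge i (0, x) = 0.
Proof.
have zero (a b c d : R) : a = 0 -> b = 0 -> a * c - b * d = 0.
  by move=> -> ->; rewrite !mul0r subr0.
exact: zero (vstress0 i.1.2) (vstress0 i.1.1).
Qed.

Lemma Dt_vdensity0 : Dt vdensity (0, x) = 0.
Proof.
rewrite /Dt /vdensity (derive_sum_seq _ _ (S0 x0) oS); last first.
  by move=> i; apply: smooth_onM => //; exact: smooth_vwedge.
by apply: big1 => i _; rewrite (derive_sqr_zero _ (S0 x0) (smooth_vwedge i)) // vwedge0.
Qed.

Lemma Dt2_vdensity0 : Dt (Dt vdensity) (0, x) = 2 * \sum_i Dt (vwedge i) (0, x) ^+ 2.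
Proof.
have sq i : smooth_on (spacetime eps) (fun p => vwedge i p * vwedge i p).
  by apply: smooth_onM => //; exact: smooth_vwedge.
transitivity (Dt (fun p => \sum_i Dt (fun p => vwedge i p * vwedge i p) p) (0, x)).
  apply: near_eq_derive; apply: filterS (open_nbhs_nbhs (conj oS (S0 x0))) => p Sp.
  by rewrite /Dt /vdensity (derive_sum_seq _ _ Sp oS).
rewrite /Dt (derive_sum_seq _ _ (S0 x0) oS); last by move=> i; exact: smooth_on_derive.
rewrite mulr_sumr; apply: eq_bigr => i _.
by rewrite (derive2_sqr_zero _ oS (S0 x0) (smooth_vwedge i)) // vwedge0.
Qed.

Section normal.
Variables (nu : 'rV[R]_(m + 1) -> 'rV[R]_(m + 1 + 1)) (f : 'rV[R]_(m + 1) -> R).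
Hypothesis hnu : unit_normal 2^-1 (@hypersphere R m 2^-1) nu.
Hypothesis sf : smooth_sphere 2^-1 f.
Hypothesis vf : variation_field 2^-1 Phi (fun x => f x *: nu x).

Let psi := normal_factor nu f.
Let V c y := psi y * normal_coord c y.

(** On the sphere this is the definition of the variation field; both sides are
constant along rays. *)
Lemma Dt_vcoord0 c y : y != 0 -> Dt (vcoord c) (0, y) = V c y.
Proof.
move=> y0; rewrite -derive_time /V /psi -(normal_factorE hnu) //.
have dc j : derivable (fun s : R => Phi s (retr 2^-1 y) 0 j) 0 1.
  have := @is_derive_time _ _ (vcoord j) 0 y.
  by move=> /(_ (@smooth_on_derivable _ _ _ _ _ _ _ (smooth_vcoord j) (S0 y0))) [].
have := vf (retr_rsphere r0 y0); rewrite derive1E derive_mx.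
  by move=> /rowP /(_ c); rewrite !mxE.
by apply/derivable_mxP => i j; rewrite (ord1 i).
Qed.

Lemma Dt_Dx (F : R * 'rV[R]_(m + 1) -> R) k y : smooth_on (spacetime eps) F -> y != 0 ->
  Dt (Dx k F) (0, y) = Dx k (Dt F) (0, y).
Proof. by move=> sF y0; exact: (@derive_comm _ _ F (0, 'e_k) (1, 0) (0, y) _ oS (S0 y0) sF). Qed.

Lemma Dt_Dx_vcoord0 c k y : y != 0 -> Dt (Dx k (vcoord c)) (0, y) = 'D_('e_k) (V c) y.
Proof.
move=> y0; rewrite (Dt_Dx k (smooth_vcoord c) y0).
rewrite -derive_space; apply: near_eq_derive.
by apply: filterS (near_neq0 y0) => z; exact: Dt_vcoord0.
Qed.

Lemma Dt_laplacian_vcoord0 c j : Dt (Dx j (Dx j (vcoord c))) (0, x) =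
  'D_('e_j) ('D_('e_j) (V c)) x.
Proof.
rewrite (Dt_Dx j (smooth_Dx j (smooth_vcoord c)) x0).
rewrite -derive_space; apply: near_eq_derive.
by apply: filterS (near_neq0 x0) => z; exact: Dt_Dx_vcoord0.
Qed.

Lemma eq_mulD (a b c d a' b' c' d' : R) : a = a' -> b = b' -> c = c' -> d = d' ->
  a * b + c * d = a' * b' + c' * d'.
Proof. by move=> -> -> -> ->. Qed.

(** Commuting the time derivative with the space derivatives turns this into the first
variation of the stress in the direction of the normal field psi N. *)
Lemma Dt_vstress0 k : Dt (vstress k) (0, x) = 2 * kappa * (m%:R - 2) * 'D_('e_k) psi x.
Proof.
have sl c : smooth_on (spacetime eps) (fun p => \sum_j Dx j (Dx j (vcoord c)) p).
  by apply: smooth_on_sum => // j; do 2!apply: smooth_Dx; exact: smooth_vcoord.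
have sd c : smooth_on (spacetime eps) (Dx k (vcoord c)).
  by apply: smooth_Dx; exact: smooth_vcoord.
rewrite /Dt /vstress (derive_sum_seq _ _ (S0 x0) oS); last first.
  by move=> c; apply: smooth_onM => //.
rewrite -(stress_normal_variation xr k (smooth_normal_factor hnu sf)); last first.
  exact: (derive_normal_factor_radial hnu).
apply: eq_bigr => c _; rewrite (derive_prod _ (S0 x0) (sd c) (sl c)).
apply: (eq_mulD (Dt_Dx_vcoord0 c k x0) (laplacian_vcoord0 c) (Dx_vcoord0 c k x0)).
rewrite (derive_sum_seq _ _ (S0 x0) oS); last first.
  by move=> j; do 2!apply: smooth_Dx; exact: smooth_vcoord.
by apply: eq_bigr => j _; exact: Dt_laplacian_vcoord0.
Qed.

Lemma Dt_vwedge0 k l c : Dt (vwedge ((k, l), c)) (0, x) =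
  2 * kappa * (m%:R - 2) * 'D_('e_l) psi x * 'D_('e_k) (hypersphere_coord c) x
  - 2 * kappa * (m%:R - 2) * 'D_('e_k) psi x * 'D_('e_l) (hypersphere_coord c) x.
Proof.
have sd j : smooth_on (spacetime eps) (Dx j (vcoord c)).
  by apply: smooth_Dx; exact: smooth_vcoord.
have sp a b : smooth_on (spacetime eps) (fun p => vstress a p * Dx b (vcoord c) p).
  by apply: smooth_onM => //; exact: smooth_vstress.
have Dp a b : Dt (fun p => vstress a p * Dx b (vcoord c) p) (0, x) =
    2 * kappa * (m%:R - 2) * 'D_('e_a) psi x * 'D_('e_b) (hypersphere_coord c) x.
  rewrite /Dt (derive_prod _ (S0 x0) (smooth_vstress a) (sd b)) vstress0 mul0r addr0.
  by rewrite -/(Dt (vstress a) (0, x)) (Dt_vstress0 a) (Dx_vcoord0 c b x0).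
rewrite /Dt (@deriveB _ _ _ (fun p => vstress l p * Dx k (vcoord c) p)
   (fun p => vstress k p * Dx l (vcoord c) p)).
- exact: (f_equal2 (fun a b => a - b) (Dp l k) (Dp k l)).
- exact: (@smooth_on_derivable _ _ _ _ _ _ _ (sp l k) (S0 x0)).
- exact: (@smooth_on_derivable _ _ _ _ _ _ _ (sp k l) (S0 x0)).
Qed.

(** The factor 12 is 2 (from the squares) times 2 (from the antisymmetric pairs k, l)
times 3 (the square of the principal curvature). *)
Lemma Dt2_vdensity0_normal : Dt (Dt vdensity) (0, x) =
  12 * (m%:R - 1) * (m%:R - 2) ^+ 2 * enorm (gradient 2^-1 f x) ^+ 2.
Proof.
rewrite Dt2_vdensity0 (gradient_sqr xr sf).
pose a k := 2 * kappa * (m%:R - 2) * 'D_('e_k) psi x.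
have -> : \sum_i Dt (vwedge i) (0, x) ^+ 2 = \sum_k \sum_l \sum_c
    (a l * 'D_('e_k) (hypersphere_coord c) x - a k * 'D_('e_l) (hypersphere_coord c) x) ^+ 2.
  rewrite pair_bigA pair_bigA; apply: eq_bigr => [[[k l] c] _] /=.
  by rewrite Dt_vwedge0.
rewrite (sum_wedge_sqr xr); last first.
  under eq_bigr do rewrite mulrCA.
  by rewrite -mulr_sumr (derive_normal_factor_radial hnu sf x0) mulr0.
have -> : \sum_k a k ^+ 2 = 3 * (m%:R - 2) ^+ 2 *
    \sum_k 'D_('e_k) (fun y => f (retr 2^-1 y)) x ^+ 2.
  rewrite mulr_sumr; apply: eq_bigr => k _.
  rewrite -(derive_normal_factor_sqr hnu sf k x0) /a !exprMn kappa_sqr.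
  by move: ('D_('e_k) psi x) => d; field.
by move: (\sum_k _) => s; ring.
Qed.

End normal.
End at_zero.
End variation.

(** * The normal variation and the Hessian *)

Section sphere_integral_linear.
Context {R : realType} {m : nat}.

Lemma sphere_integral0 (r : R) : 0 < r ->
  sphere_integral r (fun _ : 'rV[R]_(m + 1) => 0) = 0.
Proof.
move=> r0; rewrite sphere_integralE //.
have b0 : cauchy_bounded 0 (fun u : 'rV[R]_m => (2 * r / (1 + dot u u)) ^+ m * 0).
  split=> [u|u]; last by rewrite mulr0 normr0 mul0r.
  by under eq_fun do rewrite mulr0; exact: cst_continuous.
have := le_Rn_integral b0; rewrite mul0r normr_le0 => /eqP; exact.
Qed.

Lemma sphere_integralZ (r C a : R) (F : 'rV[R]_(m + 1) -> R) : 0 < r ->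
  (forall x, rsphere r x -> {for x, continuous F}) ->
  (forall x, rsphere r x -> `|F x| <= C) ->
  sphere_integral r (fun x => a * F x) = a * sphere_integral r F.
Proof.
move=> r0 cF bF; have H := cauchy_bounded_stereo r0 cF bF.
have b0 : cauchy_bounded 0 (fun u : 'rV[R]_m => (0 : R)).
  by split=> [u|u]; [exact: cst_continuous|rewrite normr0 mul0r].
have := Rn_integral_linear a H b0.
rewrite !sphere_integralE // [Rn_integral (fun=> 0)](_ : _ = 0); last first.
  by have := le_Rn_integral b0; rewrite mul0r normr_le0 => /eqP.
by rewrite addr0 => <-; congr Rn_integral; apply/funext => u; rewrite addr0 mulrCA.
Qed.

End sphere_integral_linear.

Section normal_variation.
Context {R : realType} {m : nat} (nu : 'rV[R]_(m + 1) -> 'rV[R]_(m + 1 + 1))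
  (f : 'rV[R]_(m + 1) -> R).
Hypothesis hnu : unit_normal 2^-1 (@hypersphere R m 2^-1) nu.
Hypothesis sf : smooth_sphere 2^-1 f.

(** Moving along the normal and projecting radially back to the unit sphere. As f nu is
orthogonal to the hypersphere point, the norm to divide by is explicit, and its
derivative at t = 0 vanishes. *)
Definition normal_variation (t : R) (x : 'rV[R]_(m + 1)) : 'rV[R]_(m + 1 + 1) :=
  (Num.sqrt (1 + (t * f x) * (t * f x)))^-1 *: (hypersphere 2^-1 x + (t * f x) *: nu x).

Let r0 : 0 < 2^-1 :> R. Proof. by []. Qed.

Lemma one_plus_sqr_gt0 (a : R) : 0 < 1 + a * a.
Proof. by rewrite ltr_pwDl // -expr2 sqr_ge0. Qed.

Lemma smooth_normal_variation :
  smooth_on (spacetime 1) (fun p : R * 'rV[R]_(m + 1) => normal_variation p.1 (retr 2^-1 p.2)).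
Proof.
have oS := @open_spacetime R m 1; have oU := @open_neq0 R (m + 1).
have pull (F : 'rV[R]_(m + 1) -> R) : smooth_on [set y | y != 0] F ->
    smooth_on (spacetime 1) (fun p : R * 'rV[R]_(m + 1) => F p.2).
  move=> sF k.
  have := @smooth_on_comp_affine R (R * 'rV[R]_(m + 1))%type _ _ [set y | y != 0] snd snd F.
  move=> H; apply: (@Ck_on_subset _ _ _ _ (snd @^-1` [set y | y != 0])) => [p []//|].
  apply: H => // p.
  by apply: linear_differentiable => q; exact: cvg_snd.
have st : smooth_on (spacetime 1) (fun p : R * 'rV[R]_(m + 1) => p.1).
  by apply: smooth_on_linear => q; exact: cvg_fst.
have stf : smooth_on (spacetime 1) (fun p : R * 'rV[R]_(m + 1) => p.1 * f (retr 2^-1 p.2)).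
  by apply: smooth_onM => //; exact: (pull (fun y => f (retr 2^-1 y))).
have snu c : smooth_on (spacetime 1) (fun p : R * 'rV[R]_(m + 1) => nu (retr 2^-1 p.2) 0 c).
  apply: (pull (fun y => nu (retr 2^-1 y) 0 c)).
  by have [snu _] := hnu; exact: (smooth_on_coord c oU snu).
apply: smooth_on_row => // c.
rewrite (_ : (fun p => _) = fun p : R * 'rV[R]_(m + 1) =>
  (Num.sqrt (1 + (p.1 * f (retr 2^-1 p.2)) * (p.1 * f (retr 2^-1 p.2))))^-1 *
  (hypersphere_coord c p.2 + (p.1 * f (retr 2^-1 p.2)) * nu (retr 2^-1 p.2) 0 c)); last first.
  apply/funext => p; rewrite /normal_variation mxE; congr (_ * _).
  by rewrite mxE; congr (_ + _); rewrite mxE.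
apply: smooth_onM => //.
  apply: smooth_onV => // [p _|]; first by rewrite gt_eqF // sqrtr_gt0 one_plus_sqr_gt0.
  apply: smooth_on_sqrt => // [p _|]; first exact: one_plus_sqr_gt0.
  by apply: smooth_onD => //; [exact: smooth_on_cst|exact: smooth_onM].
apply: smooth_onD => //; last exact: smooth_onM.
by apply: pull; exact: smooth_hypersphere_coord.
Qed.

Lemma smooth_variation_normal :
  smooth_variation 2^-1 1 (@hypersphere R m 2^-1) normal_variation.
Proof.
exists 1 => //; split; first exact: smooth_normal_variation.
  move=> t x _ xr; apply/rsphereP => //.
  have [_ /(_ x xr)[nt n1 _]] := hnu.
  have [_ /(_ x xr) /rsphere_dot h1] := @smooth_map_hypersphere R m.
  have n11 : dot (nu x) (nu x) = 1 by rewrite -enorm_sqr n1 expr1n.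
  rewrite /normal_variation !dotP h1 n11 (dotC (hypersphere _ _)) nt.
  have s0 : Num.sqrt (1 + (t * f x) * (t * f x)) != 0.
    by rewrite gt_eqF // sqrtr_gt0 one_plus_sqr_gt0.
  have := sqr_sqrtr (ltW (one_plus_sqr_gt0 (t * f x))).
  move: (Num.sqrt _) s0 => s s0 E.
  rewrite (_ : _ * _ = (1 + (t * f x) * (t * f x)) / s ^+ 2); last by field.
  by rewrite -E divff ?expr1n // expf_neq0.
move=> x xr; rewrite /normal_variation !mul0r addr0 sqrtr1 invr1 scale1r scale0r addr0 //.
Qed.

Lemma variation_field_normal :
  variation_field 2^-1 normal_variation (fun x => f x *: nu x).
Proof.
move=> x xr; rewrite derive1E; set a := f x.
have Hid : is_derive (0 : R) (1 : R) (fun t : R => t * a) a.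
  have := is_derive_mul (is_derive_id (0 : R) (1 : R)) (is_derive_cst a (0 : R) (1 : R)).
  by rewrite mul1r mulr0 addr0.
have Hg : is_derive (0 : R) (1 : R) (fun t : R => 1 + (t * a) * (t * a)) 0.
  have := is_deriveD (is_derive_cst (1 : R) (0 : R) (1 : R)) (is_derive_mul Hid Hid).
  by rewrite !mul0r mulr0 !addr0.
have dg : differentiable (fun t : R => 1 + (t * a) * (t * a)) 0.
  by apply/derivable1_diffP; case: Hg.
have [ds Es] := @is_derive_sqrt_comp _ _ (fun t : R => 1 + (t * a) * (t * a)) 0 1
  (one_plus_sqr_gt0 _) dg.
have Hs : is_derive (0 : R) (1 : R) (fun t : R => Num.sqrt (1 + (t * a) * (t * a))) 0.
  split; first exact: diff_derivable.
  by rewrite Es; case: Hg => _ ->; rewrite mulr0.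
have s1 : Num.sqrt (1 + (0 * a) * (0 * a)) = 1 by rewrite !mul0r addr0 sqrtr1.
have Hi := is_derive_inv Hs (_ : Num.sqrt (1 + (0 * a) * (0 * a)) != 0).
have {}Hi : is_derive (0 : R) (1 : R) (fun t : R => (Num.sqrt (1 + (t * a) * (t * a)))^-1) 0.
  have n0 : Num.sqrt (1 + (0 * a) * (0 * a)) != 0 by rewrite s1 oner_eq0.
  by move/is_derive_eq: (Hi n0); apply; rewrite oppr0 mul0r.
have Hv := is_deriveD (is_derive_cst (hypersphere 2^-1 x) (0 : R) (1 : R))
   (is_derive_scale Hid (is_derive_cst (nu x) (0 : R) (1 : R))).
have [_ E] := is_derive_scale Hi Hv.
by rewrite [LHS]E s1 invr1 scale0r !add0r scale1r scaler0 addr0.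
Qed.

End normal_variation.

Theorem theorem4p6 (R : realType) (m : nat) (hm : (1 <= m)%N)
    (nu : 'rV[R]_(m + 1) -> 'rV[R]_(m + 1 + 1))
    (hnu : unit_normal 2^-1 (@hypersphere R m 2^-1) nu) :
  [/\ critical_hatE4 2^-1 1 (@hypersphere R m 2^-1),
      forall f : 'rV[R]_(m + 1) -> R, smooth_sphere 2^-1 f ->
        hatQ4 2^-1 1 (@hypersphere R m 2^-1) (fun x => f x *: nu x)
          (3 * (m%:R - 1) * (m%:R - 2) ^+ 2 *
           sphere_integral 2^-1 (fun x => enorm (gradient 2^-1 f x) ^+ 2))
    & forall f : 'rV[R]_(m + 1) -> R, smooth_sphere 2^-1 f ->
        forall q : R,
          hatQ4 2^-1 1 (@hypersphere R m 2^-1) (fun x => f x *: nu x) q ->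
          0 <= q].
Proof.
have r0 : 0 < 2^-1 :> R by [].
have hessian (f : 'rV[R]_(m + 1) -> R) : smooth_sphere 2^-1 f ->
    hatQ4 2^-1 1 (@hypersphere R m 2^-1) (fun x => f x *: nu x)
      (3 * (m%:R - 1) * (m%:R - 2) ^+ 2 *
        sphere_integral 2^-1 (fun x => enorm (gradient 2^-1 f x) ^+ 2)).
  move=> sf; split.
    exists (normal_variation nu f); first exact: smooth_variation_normal.
    exact: variation_field_normal.
  move=> Phi [eps eps0 [sPhi Phi1 Phi0]] vf E; split.
    have z0 : `|0 : R| < eps by rewrite normr0.
    apply: filterS (near_time z0) => t te.
    by have [] := is_derive_hatE4 sPhi Phi1 te.
  have H := is_derive_derive1_hatE4 eps0 sPhi Phi1.
  apply: is_derive_eq H _.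
  pose G x := \sum_k 'D_('e_k) (fun y => f (retr 2^-1 y)) x ^+ 2 : R.
  have sG : smooth_on [set y : 'rV[R]_(m + 1) | y != 0] G.
    have oU := @open_neq0 R (m + 1).
    apply: smooth_on_sum => // k; apply: smooth_onX => //.
    exact: (smooth_on_derive _ sf).
  have cG x : rsphere 2^-1 x -> {for x, continuous G}.
    by move=> xr; apply: (sG 0%N); exact: rsphere_neq0 xr.
  have [C HC] := compact_bounded_on (@compact_rsphere R m 2^-1) cG.
  rewrite (sphere_integral_ext r0 (fun x xr => gradient_sqr xr sf)) -/G.
  have -> : sphere_integral 2^-1 (fun x => Dt (Dt (vdensity Phi)) (0, x)) =
      sphere_integral 2^-1 (fun x => 12 * (m%:R - 1) * (m%:R - 2) ^+ 2 * G x).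
    apply: sphere_integral_ext => // x xr.
    by rewrite (Dt2_vdensity0_normal eps0 sPhi Phi0 xr hnu sf vf) (gradient_sqr xr sf).
  rewrite (sphere_integralZ _ r0 cG HC).
  by move: (sphere_integral _ _) => s; field.
split => //.
  split; first exact: smooth_map_hypersphere.
  move=> Phi [eps eps0 [sPhi Phi1 Phi0]].
  have z0 : `|0 : R| < eps by rewrite normr0.
  apply: is_derive_eq (is_derive_hatE4 sPhi Phi1 z0) _.
  rewrite (sphere_integral_ext r0 (fun x xr => Dt_vdensity0 eps0 sPhi Phi0 xr)).
  by rewrite sphere_integral0 // mulr0.
move=> f sf q [[Phi sv vf] /(_ Phi sv vf)[_ [_ Eq]]].
have [_ /(_ Phi sv vf)[_ [_ E]]] := hessian f sf.
rewrite -Eq E; apply: mulr_ge0; last first.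
  by apply: sphere_integral_ge0 => x; rewrite sqr_ge0.
by rewrite mulr_ge0 ?sqr_ge0 // mulr_ge0 // subr_ge0 ler1n.
Qed.
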